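(* Fix $1<p<n$ and $p\le q<np/(n-p)$. Let $E\subset\mathbb{R}^n$ be a median porous set with $0<\operatorname{diam}(E)<\infty$. Then, for any exponents $\gamma_1,\gamma_2$ satisfying $$0>\gamma_1>\left(\frac{q}{p}(n-p)-n\right)\left(1-\frac{\overline{\dim}_M(E)}{n}\right),$$ $$0>\gamma_2=\frac{q}{p}(n-p)-n>-\mathrm{Mu}_\infty(E),$$ there exists $C>0$, depending only on $\gamma_1,\gamma_2,p,q,n$, and $E$, such that $$\left(\int_{\mathbb{R}^n}|I_1(f)(x)|^q\min\left\{d(x,E)^{\gamma_1},d(x,E)^{\gamma_2}\right\}dx\right)^{1/q}\le C\left(\int_{\mathbb{R}^n}|f(x)|^p\,dx\right)^{1/p}$$ for every $f\in L^p(\mathbb{R}^n)$. Consequently, the weighted Hardy–Sobolev inequality $$\left(\int_{\mathbb{R}^n}|f(x)|^q\min\left\{d(x,E)^{\gamma_1},d(x,E)^{\gamma_2}\right\}dx\right)^{1/q}\le C\left(\int_{\mathbb{R}^n}|\nabla f(x)|^p\,dx\right)^{1/p}$$ holds true for every $f\in C_0^1(\mathbb{R}^n)$.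
   Context: Here $d(x,E)=\inf\{|x-y|:y\in E\}$ and $\operatorname{diam}(E)=\sup\{|x-y|:x,y\in E\}$. $C_0^1(\mathbb{R}^n)$ denotes the class of continuously differentiable functions on $\mathbb{R}^n$ vanishing at $\infty$, and $I_1(f)(x)=\int_{\mathbb{R}^n}\frac{f(y)}{|x-y|^{n-1}}\,dy$. The class $A_\infty(\mathbb{R}^n)$ consists of the weights $w$ (i.e. $w\in L^1_{\rm loc}(\mathbb{R}^n)$, $w\ge0$ a.e.) with $\sup_Q\left(\frac{1}{|Q|}\int_Q w\right)\exp\left(-\frac{1}{|Q|}\int_Q\ln w\right)<\infty$, the supremum over all cubes $Q\subset\mathbb{R}^n$. A nonempty set $E\subset\mathbb{R}^n$ is called median porous if there exists $\beta>0$ with $d(\cdot,E)^{-\beta}\in A_\infty(\mathbb{R}^n)$, and for such $E$ the Muckenhoupt exponent $\mathrm{Mu}_\infty(E)>0$ is $\mathrm{Mu}_\infty(E)=\sup\{\beta>0:d(\cdot,E)^{-\beta}\in A_\infty(\mathbb{R}^n)\}$. The upper Minkowski dimension of a bounded set $E$ is $\overline{\dim}_M(E)=\limsup_{\delta\to0^+}\frac{\log N(E,\delta)}{\log(1/\delta)}$, where $N(E,\delta)$ is the smallest number of closed balls of radius $\delta$ needed to cover $E$. *)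

(* Defs.v *)
From HB Require Import structures.
From mathcomp Require Import all_boot all_order all_algebra.
From mathcomp Require Import all_classical all_reals all_analysis.
From mathcomp Require Import measurable_realfun.

Set Implicit Arguments.
Unset Strict Implicit.
Unset Printing Implicit Defensive.

Import Order.TTheory GRing.Theory Num.Theory.
Import numFieldNormedType.Exports.

Local Open Scope classical_set_scope.
Local Open Scope ring_scope.

(* Points of R^n are row vectors 'rV[R]_n.  They carry the sigma-algebra
   generated by the coordinates, i.e. the Borel sigma-algebra. *)
Fact rV_display : measure_display.
Proof. exact: default_measure_display. Qed.

Definition rV_coord (R : realType) (n : nat) (i : 'I_n) (v : 'rV[R]_n) : R :=
  v ord0 i.

Section measurable_rV.
Variables (R : realType) (n : nat).

Let rV_measurable : set (set 'rV[R]_n) := g_sigma_preimage (@rV_coord R n).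

Let rV_set0 : rV_measurable set0.
Proof. exact: sigma_algebra0. Qed.

Let rV_setC A : rV_measurable A -> rV_measurable (~` A).
Proof. exact: sigma_algebraC. Qed.

Let rV_bigcup (F : (set 'rV[R]_n)^nat) :
  (forall i, rV_measurable (F i)) -> rV_measurable (\bigcup_i F i).
Proof. exact: sigma_algebra_bigcup. Qed.

HB.instance Definition _ := @isMeasurable.Build rV_display 'rV[R]_n
  rV_measurable rV_set0 rV_setC rV_bigcup.

End measurable_rV.

Lemma measurable_rV_coord (R : realType) (n : nat) (i : 'I_n) :
  measurable_fun [set: 'rV[R]_n] (@rV_coord R n i).
Proof.
move=> _ Y mY; rewrite setTI; apply: sub_sigma_algebra => /=.
rewrite -bigcup_seq/=; exists i => /=; first by rewrite mem_index_enum.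
by exists Y => //; rewrite setTI.
Qed.

Lemma measurable_fun_rVP (R : realType) (n : nat) d (T : measurableType d)
    (f : T -> 'rV[R]_n) :
  measurable_fun [set: T] f <->
  forall i, measurable_fun [set: T] (@rV_coord R n i \o f).
Proof.
split=> [mf i|mf].
  exact: (measurableT_comp (measurable_rV_coord i)) mf.
suff prefS : g_sigma_preimage (fun i => @rV_coord R n i \o f) `<=` measurable.
  by rewrite g_sigma_preimage_comp in prefS => _ A mA; apply: prefS; exists A.
apply: smallest_sub; first exact: sigma_algebra_measurable.
rewrite -bigcup_seq; apply: bigcup_sub => i _ A [B mB <-]; exact: mf.
Qed.

Definition rV_cons (R : realType) (n : nat) (p : measurableTypeR R * 'rV[R]_n)
  : 'rV[R]_n.+1 :=
  \row_(i < n.+1) if unlift ord0 i is Some j then p.2 ord0 j else p.1.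

Definition rV_uncons (R : realType) (n : nat) (v : 'rV[R]_n.+1)
  : measurableTypeR R * 'rV[R]_n := (v ord0 ord0, \row_(j < n) v ord0 (lift ord0 j)).

Lemma rV_consK (R : realType) (n : nat) :
  cancel (@rV_cons R n) (@rV_uncons R n).
Proof.
move=> [x v]; rewrite /rV_uncons mxE unlift_none; congr pair.
by apply/rowP => j; rewrite !mxE liftK.
Qed.

Lemma measurable_rV_cons (R : realType) (n : nat) :
  measurable_fun [set: measurableTypeR R * 'rV[R]_n] (@rV_cons R n).
Proof.
apply/measurable_fun_rVP => i; have [j ij|i0] := unliftP ord0 i.
  rewrite (_ : _ \o _ = @rV_coord R n j \o snd).
    exact: measurableT_comp (measurable_rV_coord j) measurable_snd.
  by apply/funext => p; rewrite /rV_coord /= mxE ij liftK.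
rewrite (_ : _ \o _ = fst); first exact: measurable_fst.
by apply/funext => p; rewrite /rV_coord /= mxE i0 unlift_none.
Qed.

Lemma measurable_rV_uncons (R : realType) (n : nat) :
  measurable_fun [set: 'rV[R]_n.+1] (@rV_uncons R n).
Proof.
apply: measurable_fun_pair; first exact: measurable_rV_coord.
apply/measurable_fun_rVP => i.
rewrite (_ : _ \o _ = rV_coord (lift ord0 i)); first exact: measurable_rV_coord.
by apply/funext => v; rewrite /rV_coord /= mxE.
Qed.

Section lebesgue_rV_step.
Local Open Scope ereal_scope.
Variables (R : realType) (n : nat).
Variable m : {sigma_finite_measure set 'rV[R]_n -> \bar R}.

Definition rV_prod : set 'rV[R]_n.+1 -> \bar R :=
  pushforward ((@lebesgue_measure R) \x m) (@rV_cons R n).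

Let rV_prod0 : rV_prod set0 = 0.
Proof. by rewrite /rV_prod /pushforward preimage_set0 measure0. Qed.

Let rV_prod_ge0 A : 0 <= rV_prod A.
Proof. by rewrite /rV_prod /pushforward; exact: measure_ge0. Qed.

Let rV_prod_additive : semi_sigma_additive rV_prod.
Proof.
move=> F mF tF mUF; rewrite /rV_prod /pushforward preimage_bigcup.
apply: measure_semi_sigma_additive.
- by move=> k; rewrite -[X in measurable X]setTI; exact: measurable_rV_cons.
- apply/trivIsetP => /= i j _ _ ij; rewrite -preimage_setI.
  by move/trivIsetP : tF => /(_ _ _ _ _ ij) ->//; rewrite preimage_set0.
- rewrite -preimage_bigcup -[X in measurable X]setTI.
  exact: measurable_rV_cons.
Qed.

HB.instance Definition _ :=
  isMeasure.Build _ _ _ rV_prod rV_prod0 rV_prod_ge0 rV_prod_additive.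

Let rV_prod_sigma_finite : sigma_finite setT rV_prod.
Proof.
pose lm : {sigma_finite_measure set (measurableTypeR R) -> \bar R} :=
  @lebesgue_measure R.
have /sigma_finiteP[F [TF ndF Foo]] := sigma_finiteT lm.
have /sigma_finiteP[G [TG ndG Goo]] := sigma_finiteT m.
exists (fun k => @rV_uncons R n @^-1` (F k `*` G k)).
  rewrite -preimage_bigcup (_ : \bigcup_k _ = setT) ?preimage_setT//.
  rewrite -setXTT TF TG predeqE => -[x y]; split; last first.
    move=> [/= [j _ Fjx] [k _ Gky]]; exists (maxn j k) => //; split.
    - by move: x Fjx; exact/subsetPset/ndF/leq_maxl.
    - by move: y Gky; exact/subsetPset/ndG/leq_maxr.
  by move=> [k _ []/= ? ?]; split; exists k.
move=> k; have [mF Fk] := Foo k; have [mG Gk] := Goo k; split.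
  rewrite -[X in measurable X]setTI; apply: measurable_rV_uncons => //.
  exact: measurableX.
rewrite /rV_prod /pushforward -comp_preimage.
rewrite (_ : _ \o _ = id); last by apply/funext => p /=; exact: rV_consK.
by rewrite preimage_id product_measure1E// lte_mul_pinfty// ge0_fin_numE.
Qed.

HB.instance Definition _ :=
  Measure_isSigmaFinite.Build _ _ _ rV_prod rV_prod_sigma_finite.

End lebesgue_rV_step.

(* n-dimensional Lebesgue measure, as the n-fold product of the
   one-dimensional one; see lebesgue_rV_box *)
Fixpoint lebesgue_rV (R : realType) (n : nat)
    : {sigma_finite_measure set 'rV[R]_n -> \bar R} :=
  match n with
  | 0 => \d_(0 : 'rV[R]_0)
  | n'.+1 => rV_prod (lebesgue_rV R n')
  end.

Lemma lebesgue_rV_box (R : realType) (n : nat) (a b : 'rV[R]_n) :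
  (forall i, a ord0 i <= b ord0 i) ->
  lebesgue_rV R n [set v : 'rV[R]_n | forall i, a ord0 i <= v ord0 i <= b ord0 i] =
  (\prod_(i < n) (b ord0 i - a ord0 i))%:E.
Proof.
elim: n a b => [|n IHn] a b ab.
  rewrite big_ord0 /= diracE mem_set//= => -[]//.
pose a' := (rV_uncons a).2; pose b' := (rV_uncons b).2.
pose I : set (measurableTypeR R) := `[a ord0 ord0, b ord0 ord0]%classic.
pose B := [set v : 'rV[R]_n | forall i, a' ord0 i <= v ord0 i <= b' ord0 i].
transitivity (((@lebesgue_measure R) \x lebesgue_rV R n)%E (I `*` B)).
  congr ((_ \x _)%E _).
  apply/seteqP; split=> [[x v] /= xv|[x v] /= [xab vab] i].
    split; first by have := xv ord0; rewrite mxE unlift_none /I /= in_itv.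
    by move=> i; have := xv (lift ord0 i); rewrite !mxE liftK.
  rewrite mxE; case: unliftP => [j ->|->].
    by have := vab j; rewrite !mxE.
  by move: xab; rewrite /I /= in_itv.
have mB : measurable B.
  rewrite (_ : B = \bigcap_(i in [set: 'I_n])
      @rV_coord R n i @^-1` `[a' ord0 i, b' ord0 i]%classic).
    apply: fin_bigcap_measurable => // i _.
    by rewrite -[X in measurable X]setTI; apply: measurable_rV_coord.
  apply/seteqP; split=> [v vab i _|v vab i] /=.
    by rewrite in_itv; exact: vab.
  by have := vab i Logic.I; rewrite /= in_itv.
rewrite product_measure1E//; last exact: measurable_itv.
rewrite IHn; last by move=> i; rewrite !mxE; exact: ab.
rewrite big_ord_recl EFinM; congr (_ * (_)%:E)%E.
  rewrite [LHS]lebesgue_measure_itv/= lte_fin; case: ltP => // ba.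
  by rewrite (_ : b _ _ = a ord0 ord0) ?subrr//; apply/eqP; rewrite eq_le ba ab.
by apply: eq_bigr => i _; rewrite !mxE.
Qed.

Lemma open_measurable_rV (R : realType) (n : nat) (A : set 'rV[R]_n) :
  open A -> measurable A.
Proof.
move=> oA.
pose B (p : 'rV[rat]_n * nat) : set 'rV[R]_n :=
  [set v | forall i, `|v ord0 i - ratr (p.1 ord0 i)| < p.2.+1%:R^-1].
have -> : A = \bigcup_(p in [set p | B p `<=` A]) B p.
  apply/seteqP; split=> [v Av|v [p pA Bpv]]; last exact: pA.
  have /nbhs_ballP[e /= e0 eA] := open_nbhs_nbhs (conj oA Av).
  have [k ke] : exists k : nat, k.+1%:R^-1 < e / 2.
    have [k _ kP] := near_infty_natSinv_lt (PosNum (divr_gt0 e0 (ltr0Sn R 1))).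
    by exists k; exact: kP (leqnn k).
  have rP (i : 'I_n) : exists r : rat, `|v ord0 i - ratr r| < k.+1%:R^-1.
    have /rat_in_itvoo[r] :
        v ord0 i - k.+1%:R^-1 < v ord0 i + k.+1%:R^-1.
      by rewrite ltrD2l; apply: (@lt_trans _ _ 0); rewrite ?oppr_lt0.
    by rewrite in_itv/= => /andP[r1 r2]; exists r; rewrite ltr_distlC r1 r2.
  pose c : 'rV[rat]_n := \row_i projT1 (cid (rP i)).
  have cP i : `|v ord0 i - ratr (c ord0 i)| < k.+1%:R^-1.
    by rewrite mxE; case: cid.
  exists (c, k) => //= w Bw; apply: eA; split => // i j.
  rewrite ord1 /ball/=.
  have -> : v ord0 j - w ord0 j = (v ord0 j - ratr (c ord0 j)) -
     (w ord0 j - ratr (c ord0 j)) by rewrite opprB addrA subrK.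
  rewrite (le_lt_trans (ler_normB _ _))// [ltRHS](splitr e).
  by apply: ltrD; [exact: lt_trans (cP j) ke|exact: lt_trans (Bw j) ke].
rewrite bigcup_mkcond; apply: countable_bigcupT_measurable => // p.
case: ifP => // _.
rewrite (_ : B p = \bigcap_(i in [set: 'I_n])
    @rV_coord R n i @^-1` `](ratr (p.1 ord0 i) : R) - p.2.+1%:R^-1,
      ratr (p.1 ord0 i) + p.2.+1%:R^-1[%classic).
  apply: fin_bigcap_measurable => // i _.
  by rewrite -[X in measurable X]setTI; apply: measurable_rV_coord.
apply/seteqP; split=> [v Bv i _|v Bv i] /=.
  by rewrite in_itv/= -ltr_distl; exact: Bv.
by have := Bv i Logic.I; rewrite /= in_itv/= -ltr_distl.
Qed.

(* The norm `|v| of 'rV[R]_n is the maximum norm: |v| needs its own symbol. *)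
Definition enorm (R : realType) (n : nat) (v : 'rV[R]_n) : R :=
  Num.sqrt (\sum_(i < n) v ord0 i ^+ 2).

Definition edist (R : realType) (n : nat) (x : 'rV[R]_n) (E : set 'rV[R]_n)
  : R := inf [set enorm (x - y) | y in E].

Definition ediam (R : realType) (n : nat) (E : set 'rV[R]_n) : \bar R :=
  ereal_sup [set r | exists x y, [/\ E x, E y & r = (enorm (x - y))%:E]].

(* d(x, E)^a as an extended real, written exp(a ln d(x, E)) because
   0 `^ a = 0 in the library when a < 0, whereas d(x, E)^a = +oo is meant on
   the closure of E. *)
Definition edist_pow (R : realType) (n : nat) (E : set 'rV[R]_n) (a : R)
  (x : 'rV[R]_n) : \bar R := expeR (a%:E * lne (edist x E)%:E)%E.

Lemma edist_pow_gt0 (R : realType) (n : nat) (E : set 'rV[R]_n) (a : R) x :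
  0 < edist x E -> edist_pow E a x = (edist x E `^ a)%:E.
Proof.
by move=> d0; rewrite /edist_pow /= leNgt d0 /= /powR gt_eqF.
Qed.

Lemma edist_pow_eq0 (R : realType) (n : nat) (E : set 'rV[R]_n) (a : R) x :
  a < 0 -> edist x E = 0 -> edist_pow E a x = +oo%E.
Proof.
by move=> a0 d0; rewrite /edist_pow d0 /= lexx lt0_muleNy ?lte_fin.
Qed.

Section Muckenhoupt.
Local Open Scope ereal_scope.
Context {R : realType} {n : nat}.
Implicit Types (w : 'rV[R]_n -> \bar R) (Q E : set 'rV[R]_n).

Definition cube : set (set 'rV[R]_n) :=
  [set Q : set 'rV[R]_n | exists (a : 'rV[R]_n) (l : R), (0 < l)%R /\
    Q = [set x : 'rV[R]_n |
          forall i, (a ord0 i <= x ord0 i <= a ord0 i + l)%R]].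

Definition average w Q : \bar R :=
  ((fine (lebesgue_rV R n Q))^-1)%:E * \int[lebesgue_rV R n]_(x in Q) w x.

Definition weight w : Prop :=
  [/\ measurable_fun [set: 'rV[R]_n] w,
      forall K : set 'rV[R]_n, compact K ->
        \int[lebesgue_rV R n]_(x in K) `|w x| < +oo
    & {ae lebesgue_rV R n, forall x, 0 <= w x}].

Definition Ainfty w : Prop :=
  weight w /\
  ereal_sup [set average w Q * expeR (- average (@lne R \o w) Q) | Q in cube]
    < +oo.

Definition median_porous E : Prop :=
  E !=set0 /\ exists2 b : R, (0 < b)%R & Ainfty (edist_pow E (- b)%R).

Definition Muckenhoupt_exponent E : \bar R :=
  ereal_sup [set b%:E | b in
    [set b : R | (0 < b)%R /\ Ainfty (edist_pow E (- b)%R)]].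

End Muckenhoupt.

Section Minkowski.
Local Open Scope ereal_scope.
Context {R : realType} {n : nat}.
Implicit Types E : set 'rV[R]_n.

(* +oo when no finite family of balls covers E *)
Definition covering_number E (delta : R) : \bar R :=
  ereal_inf [set k%:R%:E | k in [set k : nat | exists c : 'I_k -> 'rV[R]_n,
    E `<=` \bigcup_(i in [set: 'I_k]) [set x : 'rV[R]_n | (enorm (x - c i) <= delta)%R]]].

Definition upper_Minkowski_dim E : \bar R :=
  limf_esup (fun delta : R => lne (covering_number E delta) *
    ((ln delta^-1)^-1)%:E) (0 : R)^'+.

End Minkowski.

Section Riesz.
Context {R : realType} {n : nat}.
Implicit Types f : 'rV[R]_n -> R.

Definition Riesz1 f (x : 'rV[R]_n) : \bar R :=
  (\int[lebesgue_rV R n]_y (f y / enorm (x - y) ^+ n.-1)%:E)%E.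

Definition partial f (i : 'I_n) (x : 'rV[R]_n) : R :=
  'D_(delta_mx ord0 i) f x.

Definition gradient f (x : 'rV[R]_n) : 'rV[R]_n := \row_i partial f i x.

Definition C1 f : Prop :=
  (forall x, differentiable f x) /\ forall i, continuous (partial f i).

Definition vanishes_at_infinity f : Prop :=
  forall e : R, 0 < e -> exists M : R, forall x, M < enorm x -> `|f x| < e.

Definition C10 f : Prop := C1 f /\ vanishes_at_infinity f.

Definition HS_weight (E : set 'rV[R]_n) (g1 g2 : R) (x : 'rV[R]_n) : \bar R :=
  Order.min (edist_pow E g1 x) (edist_pow E g2 x).

End Riesz.

(* Main.v *)
Require Import Defs.
From HB Require Import structures.
From mathcomp Require Import all_boot all_order all_algebra.
From mathcomp Require Import all_classical all_reals all_analysis.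
From mathcomp Require Import measurable_realfun ring lra.

Set Implicit Arguments.
Unset Strict Implicit.
Unset Printing Implicit Defensive.

Import Order.TTheory GRing.Theory Num.Theory.
Import numFieldNormedType.Exports.

Local Open Scope classical_set_scope.
Local Open Scope ring_scope.
Local Open Scope ereal_scope.
(* the point-to-set distance, not the two-point extended distance *)
Local Notation edist := Defs.edist.

(** Write [b = - gamma2], so that [q (n - p) / p = n - b], and [g = - gamma1].

    The weight splits in two.  Within distance 1 of [E] it is at most [d^-g];
    since [E] has about [delta^-D] covering balls of radius [delta], with [D]
    slightly above the upper Minkowski dimension, the set [d <= delta] has volume
    at most [C delta^(n - D)].  So the closure of [E] is a null set, and the
    hypothesis on [gamma1] puts [d^-g] in [L^s] near [E] for some [s > n / b]
    ([near_weight_integrable]).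
    At distance more than 1, boundedness of [E] gives [d >= c (1 + |x|)], and the
    weight is at most [C (1 + |x|)^-b] ([HS_weight_le]).

    For such a weight the potential inequality follows from a Schur test from
    [L^p] to [L^q] ([schur_test]): the kernel [|x - y|^(1 - n)] is factored as
    [k1^(1/q) k2^(1/p')] with [k1 = |x - y|^-A] and [k2 = |x - y|^-B], and two
    uses of Hoelder followed by Tonelli reduce the claim to
    [int k2 phi^-p' dy <= v] and [int w v^(q/p') k1 dx <= C phi^-q].  The choice
    [A = n - b + eta], [B = n - eta p' / q] and
    [phi = (1 + |y|)^(rho / p')] with small [eta], [rho] satisfies both
    ([weighted_Riesz_potential]): the exponent [A] is below [n], even after
    multiplication by the conjugate exponent of [s], so Young's inequality
    treats the singular part of the weight, and the remaining integrals are
    convolutions of powers ([convolution_powR]).  This treats [p = q] and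
    [p < q] at once, with no maximal function.

    All these integrals are estimated by dyadic decomposition, from the volume
    of sublevel sets alone ([integral_powR_near], [integral_powR_far]), and the
    kernel is measured in the maximum norm, which is at most the Euclidean one.

    The second inequality follows from the first one, in the same form, applied
    to [|grad f|]: integrating along the ray from [x] in direction [v], on which
    [f] tends to zero, gives [|f(x)| <= n |v| int_0^oo |grad f(x + t v)| dt], and
    averaging over a cube of directions [v], with the substitution
    [y = x + t v], gives [|f(x)| <= C int |x - y|^(1 - n) |grad f(y)| dy]
    ([C10_le_Riesz]). *)

(** * Comparison, geometric covering and Hoelder for nonnegative integrals *)

Section Measurability_tools.
Context d (T : measurableType d) (R : realType).
Implicit Types (h f g : T -> R) (e s : R).

Lemma measurable_funT_powR e h :
  measurable_fun [set: T] h -> measurable_fun [set: T] (fun x => h x `^ e)%R.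
Proof. by move=> mh; exact: (measurableT_comp (measurable_powR e) mh). Qed.

Lemma measurable_le_set f g :
  measurable_fun [set: T] f -> measurable_fun [set: T] g ->
  measurable [set z | (f z <= g z)%R].
Proof.
move=> mf mg; have mfg := measurable_funB mg mf.
have := mfg measurableT _ (measurable_itv `[0%R, +oo[).
rewrite setTI; congr measurable; apply/seteqP; split=> z /=;
by rewrite in_itv/= andbT subr_ge0.
Qed.

Lemma measurable_sublevel h s :
  measurable_fun [set: T] h -> measurable [set x | (h x <= s)%R].
Proof. by move=> mh; exact: (measurable_le_set mh (@measurable_cst _ _ _ _ _ s)). Qed.

Lemma measurable_superlevel h s :
  measurable_fun [set: T] h -> measurable [set x | (s < h x)%R].
Proof.
move=> mh; rewrite (_ : [set _ | _] = ~` [set x | (h x <= s)%R]).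
  by apply: measurableC; exact: measurable_sublevel.
by apply/seteqP; split=> x /=; rewrite ltNge => /negP.
Qed.

End Measurability_tools.

Section Integral_tools.
Context d (T : measurableType d) (R : realType).
Variable mu : {measure set T -> \bar R}.
Implicit Types (D : set T).

(** The integral of a nonnegative function is a supremum over the simple
    functions below it, hence monotone on all nonnegative functions, measurable
    or not. *)
Lemma le_integral_ge0 D (f g : T -> \bar R) :
  (forall x, D x -> 0 <= f x) -> (forall x, D x -> f x <= g x) ->
  \int[mu]_(x in D) f x <= \int[mu]_(x in D) g x.
Proof.
move=> f0 fg; have g0 x : D x -> 0 <= g x.
  by move=> Dx; exact: le_trans (f0 _ Dx) (fg _ Dx).
rewrite !ge0_integralE//; apply: ge_ereal_sup => _ [h /= hf <-].
apply: ereal_sup_ubound; exists h => //= x; apply: le_trans (hf x) _.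
by rewrite /patch; case: ifPn => // /set_mem/fg.
Qed.

Lemma le_integral_cover2 D D1 D2 (f g1 g2 : T -> \bar R) :
  measurable D1 -> measurable D2 ->
  measurable_fun [set: T] g1 -> measurable_fun [set: T] g2 ->
  (forall x, 0 <= g1 x) -> (forall x, 0 <= g2 x) ->
  (forall x, D x -> 0 <= f x) ->
  (forall x, D x -> (D1 x /\ f x <= g1 x) \/ (D2 x /\ f x <= g2 x)) ->
  \int[mu]_(x in D) f x <=
    \int[mu]_(x in D1) g1 x + \int[mu]_(x in D2) g2 x.
Proof.
move=> mD1 mD2 mg1 mg2 g10 g20 f0 fg.
rewrite !(integral_mkcond _ f) !(integral_mkcond _ g1) !(integral_mkcond _ g2).
have r10 x : 0 <= (g1 \_ D1) x by exact: erestrict_ge0.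
have r20 x : 0 <= (g2 \_ D2) x by exact: erestrict_ge0.
rewrite -ge0_integralD//; last 2 first.
- by apply/(measurable_restrictT _ _).1 => //; exact: measurable_funTS.
- by apply/(measurable_restrictT _ _).1 => //; exact: measurable_funTS.
apply: le_integral_ge0 => x _; first exact: erestrict_ge0.
rewrite [leLHS]patchE; case: ifPn => [/set_mem Dx|_]; last exact: adde_ge0.
have [[D1x fx]|[D2x fx]] := fg _ Dx.
  by rewrite (le_trans fx)// [X in X + _]patchE mem_set// leeDl.
by rewrite (le_trans fx)// [X in _ + X]patchE mem_set// leeDr.
Qed.

(** At each point of [D], [f] is at most the sum of the [c k] over the sets
    [A k] containing it, and this sum integrates to a geometric series. *)
Lemma integral_le_geometric D (f : T -> R) (A : (set T)^nat) (c : R^nat)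
    (M r : R) :
  (forall k, measurable (A k)) -> (forall k, (0 <= c k)%R) ->
  (0 < r < 1)%R -> (0 <= M)%R ->
  (forall k, (c k)%:E * mu (A k) <= (M * r ^+ k)%:E) ->
  (forall x, D x -> (0 <= f x)%R) ->
  (forall x, D x -> (0 < f x)%R -> exists2 k, A k x & (f x <= c k)%R) ->
  \int[mu]_(x in D) (f x)%:E <= (M / (1 - r))%:E.
Proof.
move=> mA c0 /andP[r0 r1] M0 cA f0 fA.
pose u k x : \bar R := (c k)%:E * (\1_(A k) x)%:E.
have u0 k x : 0 <= u k x by rewrite mule_ge0// lee_fin.
have mu_ k : measurable_fun [set: T] (u k).
  by apply: measurable_funeM; apply/measurable_EFinP; exact: measurable_indic.
apply: (@le_trans _ _ (\int[mu]_x (\sum_(k <oo) u k x))).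
  rewrite integral_mkcond; apply: le_integral_ge0 => [x _|x _].
    by rewrite erestrict_ge0// => y Dy; rewrite lee_fin f0.
  rewrite patchE; case: ifPn => [/set_mem Dx|_]; last exact: nneseries_ge0.
  have := f0 _ Dx; rewrite le_eqVlt => /predU1P[<-|fx]; first exact: nneseries_ge0.
  have [k Akx fck] := fA _ Dx fx.
  apply: (@le_trans _ _ (\sum_(0 <= i < k.+1) u i x)); last exact: nneseries_lim_ge.
  rewrite big_nat_recr//= /u indicE mem_set//= mule1.
  apply: (@le_trans _ _ (c k)%:E); first by rewrite lee_fin.
  by apply: leeDr; apply: sume_ge0 => i _; exact: u0.
rewrite integral_nneseries//.
apply: lime_le; first by apply: is_cvg_nneseries => k _ _; exact: integral_ge0.
apply: nearW => m; apply: (@le_trans _ _ (\sum_(0 <= k < m) (M * r ^+ k)%:E)).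
  apply: lee_sum => k _.
  rewrite /u ge0_integralZl_EFin//; last first.
    by apply/measurable_EFinP; exact: measurable_indic.
  by rewrite integral_indic// setIT.
rewrite sumEFin lee_fin; have := @geometric_le_lim R m M r M0 r0.
by apply; rewrite ger0_norm ?ltW.
Qed.

Lemma hoelder_integral (f g : T -> R) (a b : R) :
  measurable_fun [set: T] f -> measurable_fun [set: T] g ->
  (forall x, (0 <= f x)%R) -> (forall x, (0 <= g x)%R) ->
  (0 < a)%R -> (0 <= b)%R -> (a + b = 1)%R ->
  \int[mu]_x (f x `^ a * g x `^ b)%:E <=
  (\int[mu]_x (f x)%:E) `^ a * (\int[mu]_x (g x)%:E) `^ b.
Proof.
move=> mf mg f0 g0 a0; rewrite le_eqVlt => /predU1P[<-|b0] ab.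
  rewrite addr0 in ab; rewrite ab poweRe0 mule1 poweRe1; last first.
    by apply: integral_ge0 => x _; rewrite lee_fin.
  by under eq_integral do rewrite powRr1// powRr0 mulr1.
have := @hoelder _ _ _ mu (fun x => f x `^ a)%R (fun x => g x `^ b)%R a^-1 b^-1.
rewrite !invrK !invr_gt0 => /(_ (measurable_funT_powR _ mf)
  (measurable_funT_powR _ mg) a0 b0 ab).
rewrite Lnorm1 unlock !invrK => H; apply: le_trans (le_trans H _).
  apply: le_integral_ge0 => x _; first by rewrite lee_fin mulr_ge0 ?powR_ge0.
  by rewrite lee_fin ler_norm.
have E (h : T -> R) e : (0 < e)%R -> (forall x, (0 <= h x)%R) ->
    \int[mu]_x `|(EFin \o (fun x => h x `^ e)%R) x| `^ e^-1 = \int[mu]_x (h x)%:E.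
  move=> e0 h0; apply: eq_integral => x _ /=.
  by rewrite ger0_norm ?powR_ge0// -powRrM mulfV ?gt_eqF// powRr1.
by rewrite le_eqVlt; apply/orP; left; apply/eqP; congr (_ `^ _ * _ `^ _); [exact: E|exact: E].
Qed.

End Integral_tools.

(** * The Schur test from L^p to L^q *)

(** The pointwise identity behind the two Hoelder steps of the Schur test: the
    first pairs the two parentheses with exponents [p] and [p'], the second
    pairs the two factors of the first parenthesis with exponents [q / p] and
    its conjugate. *)
Lemma schur_factorization (R : realType) (a b f phi p p' q : R) :
  (0 < p)%R -> (0 < p')%R -> (0 < q)%R -> (0 <= a)%R -> (0 <= b)%R ->
  (0 <= f)%R -> (0 < phi)%R ->
  (a `^ q^-1 * b `^ p'^-1 * f =
   ((a * phi `^ q * f `^ p) `^ (p / q) * (f `^ p) `^ (1 - p / q)) `^ p^-1 *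
   (b * phi `^ (- p')) `^ p'^-1)%R.
Proof.
move=> p0 p'0 q0 a0 b0 f0 phi0.
have phiq : (0 <= phi `^ q)%R by exact: powR_ge0.
have fp : (0 <= f `^ p)%R by exact: powR_ge0.
have Ef : (f = f `^ (p / q) * f `^ (1 - p / q))%R.
  rewrite -powRD; last by rewrite addrC subrK oner_eq0.
  by rewrite addrC subrK powRr1.
have Ep : (phi `^ 1 * phi `^ (- 1) = 1)%R.
  by rewrite powRN mulfV// powR_eq0 gt_eqF.
rewrite [((_ * _) `^ p^-1)%R]powRM ?powR_ge0//.
rewrite [((a * _ * _) `^ _)%R]powRM ?mulr_ge0//.
rewrite [((a * _) `^ _)%R]powRM//.
rewrite [((b * _) `^ _)%R]powRM ?powR_ge0//.
rewrite -[(phi `^ q `^ _)%R]powRrM -[(f `^ p `^ (p / q))%R]powRrM.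
rewrite -[(f `^ p `^ (1 - _))%R]powRrM -[(phi `^ (- p') `^ _)%R]powRrM.
rewrite [((_ * _) `^ p^-1)%R]powRM ?mulr_ge0 ?powR_ge0//.
rewrite [((_ * _) `^ p^-1)%R]powRM ?powR_ge0//.
rewrite -[(a `^ _ `^ _)%R]powRrM -[(phi `^ _ `^ p^-1)%R]powRrM.
rewrite -[(f `^ (p * (p / q)) `^ _)%R]powRrM -[(f `^ _ `^ p^-1)%R]powRrM.
have -> : (q * (p / q) / p = 1)%R by field; rewrite !gt_eqF.
have -> : (p / q / p = q^-1)%R by field; rewrite !gt_eqF.
have -> : (p * (p / q) / p = p / q)%R by field; rewrite !gt_eqF.
have -> : (p * (1 - p / q) / p = 1 - p / q)%R by field; rewrite !gt_eqF.
have -> : (- p' / p' = - 1)%R by field; rewrite !gt_eqF.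
rewrite {1}Ef; move: Ep.
set a1 := (a `^ _)%R; set b1 := (b `^ _)%R; set c1 := (phi `^ 1)%R.
set c2 := (phi `^ _)%R; set f1 := (f `^ _)%R; set f2 := (f `^ _)%R => Ep.
by rewrite -[LHS]mul1r -{1}Ep; ring.
Qed.

(** Schur test with two kernels and an arbitrary positive weight [phi] as
    test function.  Hoelder gives, for fixed [x],
    [(K f)^q <= (\int k1 phi^q f^p) * (\int f^p)^(q/p - 1) * v^(q/p')],
    and Tonelli turns the second hypothesis into the claim. *)
Lemma schur_test d1 d2 (X : measurableType d1) (Y : measurableType d2)
    (R : realType) (mu : {sigma_finite_measure set X -> \bar R})
    (nu : {sigma_finite_measure set Y -> \bar R})
    (k1 k2 : X * Y -> R) (phi : Y -> R) (v w : X -> R) (p p' q C : R) :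
  (0 < p)%R -> (0 < p')%R -> (p^-1 + p'^-1 = 1)%R -> (p <= q)%R -> (0 < C)%R ->
  measurable_fun [set: X * Y] k1 -> measurable_fun [set: X * Y] k2 ->
  measurable_fun [set: Y] phi -> measurable_fun [set: X] v ->
  measurable_fun [set: X] w ->
  (forall z, (0 <= k1 z)%R) -> (forall z, (0 <= k2 z)%R) ->
  (forall y, (0 < phi y)%R) -> (forall x, (0 <= v x)%R) ->
  (forall x, (0 <= w x)%R) ->
  (forall x, \int[nu]_y (k2 (x, y) * phi y `^ (- p'))%:E <= (v x)%:E) ->
  (forall y, \int[mu]_x (w x * v x `^ (q / p') * k1 (x, y))%:E
     <= (C * phi y `^ (- q))%:E) ->
  forall f : Y -> R, measurable_fun [set: Y] f -> (forall y, (0 <= f y)%R) ->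
  \int[mu]_x ((\int[nu]_y (k1 (x, y) `^ q^-1 * k2 (x, y) `^ p'^-1 * f y)%:E) `^ q
              * (w x)%:E)
  <= C%:E * (\int[nu]_y (f y `^ p)%:E) `^ (q / p).
Proof.
move=> p0 p'0 pp' pq C0 mk1 mk2 mphi mv mw k10 k20 phi0 v0 w0 Hv Hw f mf f0.
have q0 : (0 < q)%R by exact: lt_le_trans pq.
set F := \int[nu]_y (f y `^ p)%:E.
have F0 : 0 <= F by apply: integral_ge0 => y _; rewrite lee_fin powR_ge0.
have [Fy|Ffin] := eqVneq F +oo.
  rewrite Fy poweRyr; last by rewrite mulf_neq0 ?invr_neq0 ?gt_eqF.
  by rewrite gt0_muley ?lte_fin// leey.
have {}Ffin : F \is a fin_num by rewrite ge0_fin_numE// ltey.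
have msec (k : X * Y -> R) x : measurable_fun [set: X * Y] k ->
    measurable_fun [set: Y] (fun y => k (x, y)).
  by move=> mk; exact: measurableT_comp (measurable_pair1 x).
have msec2 (k : X * Y -> R) y : measurable_fun [set: X * Y] k ->
    measurable_fun [set: X] (fun x => k (x, y)).
  by move=> mk; exact: measurableT_comp (measurable_pair2 y).
pose G x := \int[nu]_y (k1 (x, y) * phi y `^ q * f y `^ p)%:E.
have G0 x : 0 <= G x.
  by apply: integral_ge0 => y _; rewrite lee_fin !mulr_ge0 ?powR_ge0.
have mphi2 : measurable_fun [set: X * Y] (fun z => phi z.2 `^ q)%R.
  by apply: measurable_funT_powR; exact: measurableT_comp mphi measurable_snd.
have mf2 : measurable_fun [set: X * Y] (fun z => f z.2 `^ p)%R.
  by apply: measurable_funT_powR; exact: measurableT_comp mf measurable_snd.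
have mG : measurable_fun [set: X] G.
  apply: (measurable_fun_fubini_tonelli_F
    (fun z => (k1 z * phi z.2 `^ q * f z.2 `^ p)%:E)).
    apply/measurable_EFinP; apply: measurable_funM => //.
    exact: measurable_funM.
  by move=> z; rewrite lee_fin !mulr_ge0 ?powR_ge0.
(* Hoelder with exponents p, p', then q/p and its conjugate *)
have Hpt x : (\int[nu]_y (k1 (x, y) `^ q^-1 * k2 (x, y) `^ p'^-1 * f y)%:E) `^ q
    <= G x * F `^ (q / p - 1) * (v x `^ (q / p'))%:E.
  pose u y := ((k1 (x, y) * phi y `^ q * f y `^ p) `^ (p / q)
               * (f y `^ p) `^ (1 - p / q))%R.
  have mu_ : measurable_fun [set: Y] u.
    apply: measurable_funM; apply: measurable_funT_powR.
      by apply: measurable_funM; [apply: measurable_funM|];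
        [exact: msec|exact: measurable_funT_powR..].
    exact: measurable_funT_powR.
  have Hu : \int[nu]_y (u y)%:E <= G x `^ (p / q) * F `^ (1 - p / q).
    apply: hoelder_integral.
    - by apply: measurable_funM; [apply: measurable_funM|];
        [exact: msec|exact: measurable_funT_powR..].
    - exact: measurable_funT_powR.
    - by move=> y; rewrite !mulr_ge0 ?powR_ge0.
    - by move=> y; rewrite powR_ge0.
    - by rewrite divr_gt0.
    - by rewrite subr_ge0 ler_pdivrMr// mul1r.
    - by rewrite addrC subrK.
  have J0 : 0 <= \int[nu]_y (k1 (x, y) `^ q^-1 * k2 (x, y) `^ p'^-1 * f y)%:E.
    by apply: integral_ge0 => y _; rewrite lee_fin !mulr_ge0 ?powR_ge0.
  have HJ : \int[nu]_y (k1 (x, y) `^ q^-1 * k2 (x, y) `^ p'^-1 * f y)%:E <=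
      (G x `^ (p / q) * F `^ (1 - p / q)) `^ p^-1 * (v x)%:E `^ p'^-1.
    apply: (@le_trans _ _ ((\int[nu]_y (u y)%:E) `^ p^-1 *
        (\int[nu]_y (k2 (x, y) * phi y `^ (- p'))%:E) `^ p'^-1)); last first.
      apply: lee_pmul; rewrite ?poweR_ge0//.
        apply: gt0_ler_poweR; rewrite ?invr_ge0 ?(ltW p0)//.
          rewrite in_itv/= leey andbT.
          by apply: integral_ge0 => y _; rewrite lee_fin mulr_ge0 ?powR_ge0.
        by rewrite in_itv/= leey andbT mule_ge0// poweR_ge0.
      apply: gt0_ler_poweR; rewrite ?invr_ge0 ?(ltW p'0) ?Hv//.
        rewrite in_itv/= leey andbT.
        by apply: integral_ge0 => y _; rewrite lee_fin mulr_ge0 ?powR_ge0.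
      by rewrite in_itv/= leey andbT lee_fin.
    have -> : \int[nu]_y (k1 (x, y) `^ q^-1 * k2 (x, y) `^ p'^-1 * f y)%:E =
       \int[nu]_y (u y `^ p^-1 * (k2 (x, y) * phi y `^ (- p')) `^ p'^-1)%:E.
      by apply: eq_integral => y _; congr (_%:E); exact: schur_factorization.
    apply: hoelder_integral => //.
    - by apply: measurable_funM; [exact: msec|exact: measurable_funT_powR].
    - by move=> y; rewrite /u mulr_ge0 ?powR_ge0.
    - by move=> y; rewrite mulr_ge0 ?powR_ge0.
    - by rewrite invr_gt0.
    - by rewrite invr_ge0 ltW.
  have := @gt0_ler_poweR _ q (ltW q0) _ _ _ _ HJ.
  rewrite !in_itv/= !leey !andbT J0 => /(_ isT).
  rewrite mule_ge0 ?poweR_ge0 ?lee_fin ?powR_ge0// => /(_ isT) H; apply: (le_trans H).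
  have v1 : 0 <= (v x)%:E `^ p'^-1 by exact: poweR_ge0.
  rewrite poweRM ?poweR_ge0//.
  rewrite -[((_ * _) `^ p^-1) `^ q]poweRrM poweRM ?poweR_ge0//.
  rewrite -!poweRrM.
  have -> : (p / q * (p^-1 * q) = 1)%R by field; rewrite !gt_eqF.
  have -> : ((1 - p / q) * (p^-1 * q) = q / p - 1)%R by field; rewrite !gt_eqF.
  by rewrite poweRe1//= -powRrM [(p'^-1 * q)%R]mulrC.
apply: (@le_trans _ _ (\int[mu]_x
    (F `^ (q / p - 1) * (G x * (w x * v x `^ (q / p'))%:E)))).
  apply: le_integral_ge0 => x _; first by rewrite mule_ge0 ?poweR_ge0// lee_fin.
  apply: (le_trans (lee_wpmul2r _ (Hpt x))); first by rewrite lee_fin.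
  by rewrite (muleC (G x)) -!muleA -EFinM [(_ * w x)%R]mulrC.
rewrite ge0_integralZl//; last 3 first.
- apply: emeasurable_funM => //; apply/measurable_EFinP.
  by apply: measurable_funM => //; exact: measurable_funT_powR.
- by move=> x _; rewrite mule_ge0// lee_fin mulr_ge0// powR_ge0.
- exact: poweR_ge0.
have -> : \int[mu]_x (G x * (w x * v x `^ (q / p'))%:E) =
    \int[mu]_x \int[nu]_y (w x * v x `^ (q / p') * k1 (x, y) *
       (phi y `^ q * f y `^ p))%:E.
  apply: eq_integral => x _.
  transitivity (\int[nu]_y ((k1 (x, y) * phi y `^ q * f y `^ p)%:E
                            * (w x * v x `^ (q / p'))%:E)).
    apply/esym/ge0_integralZr => //.
    - apply/measurable_EFinP; apply: measurable_funM; last exact: measurable_funT_powR.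
      by apply: measurable_funM; [exact: msec|exact: measurable_funT_powR].
    - by move=> y _; rewrite lee_fin !mulr_ge0 ?powR_ge0.
    - by rewrite lee_fin mulr_ge0 ?powR_ge0.
  by apply: eq_integral => y _; rewrite -EFinM; congr (_%:E); ring.
rewrite (fubini_tonelli (fun z => (w z.1 * v z.1 `^ (q / p') * k1 z *
       (phi z.2 `^ q * f z.2 `^ p))%:E)); last 2 first.
- apply/measurable_EFinP; apply: measurable_funM; last exact: measurable_funM.
  apply: measurable_funM => //.
  apply: (measurableT_comp (f := fun x => w x * v x `^ (q / p'))%R) => //.
  by apply: measurable_funM => //; exact: measurable_funT_powR.
- by move=> z; rewrite lee_fin !mulr_ge0 ?powR_ge0.
apply: (@le_trans _ _ (F `^ (q / p - 1) * (C%:E * F))); last first.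
  have -> : F `^ (q / p) = F `^ (q / p - 1) * F.
    rewrite -{3}(poweRe1 F0) -poweRD ?subrK//.
    by apply: add_neq0_poweRD_def; rewrite subrK mulf_neq0 ?invr_neq0 ?gt_eqF.
  by rewrite muleCA.
apply: lee_wpmul2l; first exact: poweR_ge0.
rewrite /F -ge0_integralZl_EFin//; last 3 first.
- by move=> y _; rewrite lee_fin powR_ge0.
- by apply/measurable_EFinP; exact: measurable_funT_powR.
- exact: ltW.
apply: le_integral_ge0 => y _.
  by apply: integral_ge0 => x _; rewrite lee_fin !mulr_ge0 ?powR_ge0.
rewrite /=; under eq_integral do rewrite EFinM.
rewrite ge0_integralZr//; last 3 first.
- apply/measurable_EFinP; apply: measurable_funM; last exact: msec2.
  by apply: measurable_funM => //; exact: measurable_funT_powR.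
- by move=> x _; rewrite lee_fin !mulr_ge0 ?powR_ge0.
- by rewrite lee_fin !mulr_ge0 ?powR_ge0.
apply: (le_trans (lee_wpmul2r _ (Hw y))); first by rewrite lee_fin mulr_ge0 ?powR_ge0.
rewrite -EFinM lee_fin powRN mulrA divfK//.
by rewrite powR_eq0 gt_eqF.
Qed.

(** * Integrals of powers from the volume of sublevel sets *)

Section Power_facts.
Context (R : realType).
Implicit Types a b c e x : R.

Lemma powR_exprn x e (k : nat) : (0 <= x)%R -> ((x ^+ k) `^ e = (x `^ e) ^+ k)%R.
Proof. 
move=> x0; rewrite -(powR_mulrn k x0) -(powR_mulrn k (powR_ge0 x e)).
exact: powRAC.
 Qed.

Lemma ler_powRN a c x : (0 <= a)%R -> (0 < c)%R -> (c <= x)%R ->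
  (x `^ (- a) <= c `^ (- a))%R.
Proof.
move=> a0 c0 cx; rewrite !powRN lef_pV2 ?posrE ?powR_gt0//; last exact: lt_le_trans cx.
by apply: ge0_ler_powR; rewrite ?nnegrE//; apply: ltW => //; exact: lt_le_trans cx.
Qed.

Lemma powR_lt1 x e : (0 < x < 1)%R -> (0 < e)%R -> (0 < x `^ e < 1)%R.
Proof.
move=> /andP[x0 x1] e0; rewrite powR_gt0//=.
by have := gt0_ltr_powR e0; move=> /(_ x 1%R); rewrite !nnegrE ltW// ler01 powR1; apply.
Qed.

Lemma powR2N e : ((2 : R) `^ (- e) = 2^-1 `^ e)%R.
Proof. by rewrite -(@powR_inv1 _ 2)// -powRrM mulN1r. Qed.

Lemma dyadic_floor x c : (0 < x)%R -> (x <= c)%R ->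
  exists k, (c * 2^-1 ^+ k.+1 < x <= c * 2^-1 ^+ k)%R.
Proof.
move=> x0 xc; have c0 : (0 < c)%R by exact: lt_le_trans xc.
have ex : exists k, (c * 2^-1 ^+ k.+1 < x)%R.
  have := @upper_nthrootP _ (c / x)%R _ (leqnSn (Num.bound (c / x)%R)).
  rewrite ltr_pdivrMr// => cx; exists (Num.bound (c / x)%R).
  by rewrite exprVn ltr_pdivrMr ?exprn_gt0// mulrC.
case: (ex_minnP ex) => -[|k] kx kmin.
  by exists 0%N; rewrite kx expr0 mulr1 xc.
exists k.+1; rewrite kx leNgt; apply/negP => /kmin.
by rewrite ltnn.
Qed.

End Power_facts.

Section Power_integrals.
Context d (T : measurableType d) (R : realType).
Variable mu : {measure set T -> \bar R}.
Variables (h : T -> R) (m C rho a : R).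
Hypotheses (mh : measurable_fun [set: T] h).
Hypotheses (C0 : (0 <= C)%R) (rho0 : (0 < rho)%R) (a0 : (0 < a)%R).

Let mlevel s : measurable [set x | (h x <= s)%R].
Proof. exact: measurable_sublevel. Qed.

(** Cut [h <= rho] into the dyadic shells [rho 2^-(k+1) < h <= rho 2^-k].  The
    convention [0 `^ (- a) = 0] makes the zero set of [h] harmless. *)
Lemma integral_powR_near : (forall x, (0 <= h x)%R) -> (a < m)%R ->
  (forall s, (0 < s <= rho)%R -> mu [set x | (h x <= s)%R] <= (C * s `^ m)%:E) ->
  \int[mu]_(x in [set x | (h x <= rho)%R]) (h x `^ (- a))%:E <=
  (C * rho `^ (m - a) * 2^-1 `^ (- a) / (1 - 2^-1 `^ (m - a)))%:E.
Proof.
move=> h0 am vol.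
have z01 : (0 < (2^-1 : R) < 1)%R by rewrite invr_gt0 invf_lt1 ?ltr0n ?ltr1n.
have z0 : (0 < (2^-1 : R))%R by case/andP: z01.
apply: (@integral_le_geometric _ _ _ _ _ _
  (fun k => [set x | (h x <= rho * 2^-1 ^+ k)%R])
  (fun k => (rho * 2^-1 ^+ k.+1) `^ (- a))%R) => //.
- by move=> k; exact: powR_ge0.
- by apply: powR_lt1; rewrite ?subr_gt0.
- by rewrite !mulr_ge0 ?powR_ge0.
- move=> k; have pk : (0 < rho * 2^-1 ^+ k)%R by rewrite mulr_gt0// exprn_gt0.
  apply: (@le_trans _ _ (((rho * 2^-1 ^+ k.+1) `^ (- a))%:E *
                         (C * (rho * 2^-1 ^+ k) `^ m)%:E)).
    apply: lee_wpmul2l; first by rewrite lee_fin powR_ge0.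
    by apply: vol; rewrite pk/= ger_pMr// exprn_ile1// ltW//; case/andP: z01.
  rewrite -EFinM lee_fin.
  rewrite [((rho * _ ^+ k.+1) `^ _)%R]powRM ?exprn_ge0 ?(ltW rho0) ?(ltW z0)//.
  rewrite [((rho * _ ^+ k) `^ _)%R]powRM ?exprn_ge0 ?(ltW rho0) ?(ltW z0)//.
  rewrite !powR_exprn ?(ltW z0)// [((2^-1 `^ _) ^+ k.+1)%R]exprS.
  rewrite [(rho `^ (m - a))%R]powRD; last by apply/implyP => _; rewrite gt_eqF.
  rewrite [(2^-1 `^ (m - a))%R]powRD; last by apply/implyP => _; rewrite gt_eqF.
  rewrite exprMn le_eqVlt; apply/orP; left; apply/eqP.
  set x1 := (rho `^ _)%R; set x2 := (rho `^ _)%R; set x3 := ((2^-1 `^ _) ^+ k)%R.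
  by set x4 := ((2^-1 `^ _) ^+ k)%R; set x5 := (2^-1 `^ _)%R; ring.
- by move=> x _; exact: powR_ge0.
- move=> x /= hx fx.
  have hx0 : (0 < h x)%R.
    rewrite lt_neqAle h0 andbT eq_sym; apply: contraTneq fx => ->.
    by rewrite powR0 ?ltxx// oppr_eq0 gt_eqF.
  have [k /andP[k1 k2]] := dyadic_floor hx0 hx; exists k => //.
  by apply: ler_powRN; rewrite ?(ltW a0)// ?mulr_gt0 ?exprn_gt0// ltW.
Qed.

(** The same with the shells [rho 2^k <= h <= rho 2^(k+1)], the exponent [a]
    now being large enough for the sum over the distant shells to converge. *)
Lemma integral_powR_far : (m < a)%R ->
  (forall s, (rho <= s)%R -> mu [set x | (h x <= s)%R] <= (C * s `^ m)%:E) ->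
  \int[mu]_(x in [set x | (rho < h x)%R]) (h x `^ (- a))%:E <=
  (C * rho `^ (m - a) * 2 `^ m / (1 - 2 `^ (m - a)))%:E.
Proof.
move=> ma vol; have two0 : (0 < (2 : R))%R by [].
apply: (@integral_le_geometric _ _ _ _ _ _
  (fun k => [set x | (h x <= rho * 2 ^+ k.+1)%R])
  (fun k => (rho * 2 ^+ k) `^ (- a))%R) => //.
- by move=> k; exact: powR_ge0.
- rewrite -[(m - a)%R]opprK powR2N; apply: powR_lt1; last by rewrite opprB subr_gt0.
  by rewrite invr_gt0 invf_lt1 ?ltr0n ?ltr1n.
- by rewrite !mulr_ge0 ?powR_ge0.
- move=> k.
  apply: (@le_trans _ _ (((rho * 2 ^+ k) `^ (- a))%:E *
                         (C * (rho * 2 ^+ k.+1) `^ m)%:E)).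
    apply: lee_wpmul2l; first by rewrite lee_fin powR_ge0.
    by apply: vol; rewrite ler_peMr ?(ltW rho0)// exprn_ege1// ler1n.
  rewrite -EFinM lee_fin.
  rewrite [((rho * _ ^+ k) `^ _)%R]powRM ?exprn_ge0 ?(ltW rho0)//.
  rewrite [((rho * _ ^+ k.+1) `^ _)%R]powRM ?exprn_ge0 ?(ltW rho0)//.
  rewrite !powR_exprn// [((2 `^ _) ^+ k.+1)%R]exprS.
  rewrite [(rho `^ (m - a))%R]powRD; last by apply/implyP => _; rewrite gt_eqF.
  rewrite [(2 `^ (m - a))%R]powRD; last by apply/implyP => _; rewrite gt_eqF.
  rewrite exprMn le_eqVlt; apply/orP; left; apply/eqP.
  set x1 := (rho `^ _)%R; set x2 := (rho `^ _)%R; set x3 := ((2 `^ _) ^+ k)%R.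
  by set x4 := ((2 `^ _) ^+ k)%R; set x5 := (2 `^ _)%R; ring.
- by move=> x _; exact: powR_ge0.
- move=> x /= hx _; have h0 := lt_trans rho0 hx.
  have [k /andP[k1 k2]] := dyadic_floor rho0 (ltW hx); exists k.
    apply: ltW; rewrite -ltr_pdivrMr ?exprn_gt0//.
    by rewrite -exprVn.
  apply: ler_powRN; rewrite ?(ltW a0)// ?mulr_gt0 ?exprn_gt0//.
  by rewrite -ler_pdivlMr ?exprn_gt0// -exprVn.
Qed.

End Power_integrals.

(** * The maximum norm and Lebesgue measure *)

Section Rn_norm.
Context {R : realType} {n : nat}.
Implicit Types (x y v : 'rV[R]_n) (r : R).

Lemma rV_norm_leP v r : (0 <= r)%R ->
  reflect (forall i, (`|v ord0 i| <= r)%R) (`|v| <= r)%R.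
Proof.
move=> r0; rewrite [(`|v|)%R]mx_normrE; apply: (iffP (bigmax_leP _ _ _ _)).
  by move=> [_ H] i; have := H (ord0, i) isT.
by move=> H; split => // -[i j] _ /=; rewrite ord1.
Qed.

Lemma rV_normE_le x y r : (0 <= r)%R -> [set z | (`|x - z| <= r)%R] =
  [set z : 'rV[R]_n | forall i, (x ord0 i - r <= z ord0 i <= x ord0 i + r)%R].
Proof.
move=> r0; apply/seteqP; split=> z /=.
  move=> /(rV_norm_leP _ r0) H i; have := H i.
  by rewrite !mxE ler_distlC.
by move=> H; apply/(rV_norm_leP _ r0) => i; rewrite !mxE ler_distlC.
Qed.

Lemma lebesgue_rV_ball x r : (0 <= r)%R ->
  lebesgue_rV R n [set y | (`|x - y| <= r)%R] = ((2 * r) ^+ n)%:E.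
Proof.
move=> r0; have -> : [set y | (`|x - y| <= r)%R] =
    [set z : 'rV[R]_n | forall i, ((x - const_mx r) ord0 i <= z ord0 i
                                  <= (x + const_mx r) ord0 i)%R].
  rewrite rV_normE_le//; apply/seteqP; split=> z /= H i; have := H i;
    by rewrite !mxE.
rewrite lebesgue_rV_box; last by move=> i; rewrite !mxE; lra.
congr (_%:E); rewrite (eq_bigr (fun=> (2 * r)%R)); last first.
  by move=> i _; rewrite !mxE; lra.
by rewrite prodr_const card_ord.
Qed.

Lemma continuous_measurable_rV (f : 'rV[R]_n -> R) :
  continuous f -> measurable_fun [set: 'rV[R]_n] f.
Proof.
move=> /continuousP cf; apply: (measurability _ (RGenOpens.measurableE R)).
move=> _ [_ [a [b ->] <-]]; rewrite setTI; apply: open_measurable_rV.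
exact/cf/interval_open.
Qed.

Lemma measurable_rV_norm : measurable_fun [set: 'rV[R]_n] (fun v => `|v|%R).
Proof. by apply: continuous_measurable_rV => v; exact: norm_continuous. Qed.

Lemma measurable_rV_sub :
  measurable_fun [set: 'rV[R]_n * 'rV[R]_n] (fun z => z.1 - z.2)%R.
Proof.
apply/measurable_fun_rVP => i.
rewrite (_ : _ \o _ = (rV_coord i \o fst) \- (rV_coord i \o snd))%R.
  apply: measurable_funB.
    exact: measurableT_comp (measurable_rV_coord i) measurable_fst.
  exact: measurableT_comp (measurable_rV_coord i) measurable_snd.
by apply/funext => z; rewrite /rV_coord /= !mxE.
Qed.

Lemma measurable_rV_dist :
  measurable_fun [set: 'rV[R]_n * 'rV[R]_n] (fun z => `|z.1 - z.2|%R).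
Proof. exact: measurableT_comp measurable_rV_norm measurable_rV_sub. Qed.

Lemma measurable_rV_distl x : measurable_fun [set: 'rV[R]_n] (fun y => `|x - y|%R).
Proof.
exact: (measurableT_comp measurable_rV_dist (measurable_pair1 x)).
Qed.

End Rn_norm.

(** * Convolution of powers *)

Section Convolution.
Context {R : realType} {n : nat}.
Local Notation mu := (lebesgue_rV R n).
Local Notation N := (n%:R : R).
Implicit Types (x y : 'rV[R]_n) (s a t : R).

Lemma lebesgue_rV_dist_le x s : (0 < s)%R ->
  mu [set y | (`|x - y| <= s)%R] = (2 ^+ n * s `^ N)%:E.
Proof.
by move=> s0; rewrite lebesgue_rV_ball ?ltW// powR_mulrn ?ltW// exprMn.
Qed.

Lemma measurable_jap : measurable_fun [set: 'rV[R]_n] (fun y => 1 + `|y|)%R.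
Proof. by apply: measurable_funD => //; exact: measurable_rV_norm. Qed.

Lemma lebesgue_rV_jap_le s : (0 < s)%R ->
  mu [set y | (1 + `|y| <= s)%R] <= (2 ^+ n * s `^ N)%:E.
Proof.
move=> s0; rewrite -(lebesgue_rV_dist_le 0 s0); apply: le_measure; rewrite ?inE.
- exact: measurable_sublevel measurable_jap.
- exact: measurable_sublevel (measurable_rV_distl 0%R).
- by move=> y /= ys; rewrite sub0r normrN; lra.
Qed.

Lemma integral_dist_powR_near x a s : (0 < a < N)%R -> (0 < s)%R ->
  \int[mu]_(y in [set y | (`|x - y| <= s)%R]) (`|x - y| `^ (- a))%:E <=
  (2 ^+ n * s `^ (N - a) * 2^-1 `^ (- a) / (1 - 2^-1 `^ (N - a)))%:E.
Proof.
move=> /andP[a0 aN] s0; apply: integral_powR_near => //.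
- exact: measurable_rV_distl.
- by move=> e /andP[e0 _]; rewrite [leLHS](lebesgue_rV_dist_le x e0).
Qed.

(** Where [y] is within [(1 + |x|) / 2] of [x], the second factor has size
    [(1 + |x|)^-t] and the first one is integrated over a ball; elsewhere
    [1 + |y| <= 3 |x - y|], so [|x - y|] is comparable to the larger of
    [1 + |x|] and [1 + |y|]. *)
Lemma convolution_powR a t : (0 < a < N)%R -> (0 < t < N)%R -> (N < a + t)%R ->
  exists2 C : R, (0 < C)%R & forall x,
    \int[mu]_y (`|x - y| `^ (- a) * (1 + `|y|) `^ (- t))%:E <=
    (C * (1 + `|x|) `^ (N - a - t))%:E.
Proof.
move=> /andP[a0 aN] /andP[t0 tN] at_; pose z : R := (2^-1)%R.
have z0 : (0 < z)%R by rewrite invr_gt0.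
have z1 : (0 < z < 1)%R by rewrite z0 invf_lt1 ?ltr1n.
have zlt e : (0 < e)%R -> (z `^ e < 1)%R by move=> /(powR_lt1 z1)/andP[].
pose K1 : R := (2 ^+ n * z `^ (- a) / (1 - z `^ (N - a)))%R.
pose K2 : R := (2 ^+ n * z `^ (- t) / (1 - z `^ (N - t)))%R.
pose K3 : R := (2 ^+ n * 2 `^ N / (1 - 2 `^ (N - (a + t))))%R.
have K10 : (0 < K1)%R.
  by rewrite divr_gt0 ?mulr_gt0 ?exprn_gt0 ?powR_gt0// subr_gt0 zlt// subr_gt0.
have K20 : (0 < K2)%R.
  by rewrite divr_gt0 ?mulr_gt0 ?exprn_gt0 ?powR_gt0// subr_gt0 zlt// subr_gt0.
have K30 : (0 < K3)%R.
  rewrite divr_gt0 ?mulr_gt0 ?exprn_gt0 ?powR_gt0// subr_gt0.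
  rewrite -[(N - _)%R]opprB powR2N.
  by rewrite zlt// subr_gt0.
exists (K1 * z `^ (N - a) * z `^ (- t) + K2 * z `^ (- a) * 3 `^ (N - t)
        + K3 * z `^ (- a) * 3 `^ (N - a - t))%R.
  by do 2 ?apply: addr_gt0; do 2 (apply: mulr_gt0; last exact: powR_gt0).
move=> x; set X := (1 + `|x|)%R.
have X0 : (0 < X)%R by rewrite ltr_pwDl.
have m1 : measurable_fun [set: 'rV[R]_n] (fun y => `|x - y| `^ (- a))%R.
  by apply: measurable_funT_powR; exact: measurable_rV_distl.
have mj e : measurable_fun [set: 'rV[R]_n] (fun y => (1 + `|y|) `^ e)%R.
  by apply: measurable_funT_powR; exact: measurable_jap.
have f0 y : 0 <= (`|x - y| `^ (- a) * (1 + `|y|) `^ (- t))%:E.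
  by rewrite lee_fin mulr_ge0 ?powR_ge0.
apply: (@le_trans _ _ (((z * X) `^ (- t) * (2 ^+ n * (z * X) `^ (N - a)
    * z `^ (- a) / (1 - z `^ (N - a))))%:E + 
  (((z * X) `^ (- a) * (2 ^+ n * (3 * X) `^ (N - t)
    * z `^ (- t) / (1 - z `^ (N - t))))%:E +
  (z `^ (- a) * (2 ^+ n * (3 * X) `^ (N - (a + t))
    * 2 `^ N / (1 - 2 `^ (N - (a + t)))))%:E))).
  have mf : measurable_fun [set: 'rV[R]_n]
      (fun y => (`|x - y| `^ (- a) * (1 + `|y|) `^ (- t))%:E).
    by apply/measurable_EFinP; exact: measurable_funM.
  apply: (@le_trans _ _ (
      \int[mu]_(y in [set y | (`|x - y| <= z * X)%R])
         (((z * X) `^ (- t))%:E * (`|x - y| `^ (- a))%:E) +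
      \int[mu]_(y in [set y | (z * X < `|x - y|)%R])
         (`|x - y| `^ (- a) * (1 + `|y|) `^ (- t))%:E)).
    apply: le_integral_cover2 => //.
    - exact: measurable_sublevel (measurable_rV_distl x).
    - exact: measurable_superlevel (measurable_rV_distl x).
    - by apply: measurable_funeM; exact/measurable_EFinP.
    - by move=> y; rewrite mule_ge0// lee_fin powR_ge0.
    move=> y _; have [xy|xy] := leP (`|x - y|)%R (z * X)%R; [left|right] => //.
    split=> //; rewrite -EFinM lee_fin mulrC ler_wpM2r ?powR_ge0//.
    apply: ler_powRN; rewrite ?mulr_gt0 ?(ltW t0)//.
    have := ler_normB x (x - y)%R; rewrite opprB addrC subrK.
    have := ler_normD (x - y)%R y; rewrite subrK.
    by rewrite /X /z in xy *; lra.
  apply: leeD.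
    rewrite ge0_integralZl_EFin; last 4 first.
    - exact: measurable_sublevel (measurable_rV_distl x).
    - by move=> y _; rewrite lee_fin powR_ge0.
    - by apply/measurable_EFinP; exact: measurable_funTS.
    - exact: powR_ge0.
    rewrite EFinM; apply: lee_wpmul2l; first by rewrite lee_fin powR_ge0.
    by apply: integral_dist_powR_near; rewrite ?mulr_gt0// a0.
  apply: (@le_trans _ _ (
      \int[mu]_(y in [set y | (1 + `|y| <= 3 * X)%R])
         (((z * X) `^ (- a))%:E * ((1 + `|y|) `^ (- t))%:E) +
      \int[mu]_(y in [set y | (3 * X < 1 + `|y|)%R])
         ((z `^ (- a))%:E * ((1 + `|y|) `^ (- (a + t)))%:E))).
    apply: le_integral_cover2 => //.
    - exact: measurable_sublevel measurable_jap.
    - exact: measurable_superlevel measurable_jap.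
    - by apply: measurable_funeM; exact/measurable_EFinP.
    - by apply: measurable_funeM; exact/measurable_EFinP.
    - by move=> y; rewrite mule_ge0// lee_fin powR_ge0.
    - by move=> y; rewrite mule_ge0// lee_fin powR_ge0.
    move=> y /= xy; have [yX|yX] := leP (1 + `|y|)%R (3 * X)%R; [left|right].
      split=> //; rewrite -EFinM lee_fin ler_wpM2r ?powR_ge0//.
      by apply: ler_powRN; rewrite ?mulr_gt0 ?(ltW a0)// ltW.
    split=> //; have y0 : (0 < 1 + `|y|)%R by rewrite ltr_pwDl.
    rewrite opprD powRD; last by apply/implyP => _; rewrite gt_eqF.
    rewrite -EFinM lee_fin mulrA ler_wpM2r ?powR_ge0//.
    rewrite -powRM ?(ltW z0) ?(ltW y0)//.
    apply: ler_powRN; rewrite ?mulr_gt0 ?(ltW a0)//.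
    have := ler_normB x (x - y)%R; rewrite opprB addrC subrK.
    by rewrite /X /z in yX *; lra.
  apply: leeD.
    rewrite ge0_integralZl_EFin; last 4 first.
    - exact: measurable_sublevel measurable_jap.
    - by move=> y _; rewrite lee_fin powR_ge0.
    - by apply/measurable_EFinP; exact: measurable_funTS.
    - exact: powR_ge0.
    rewrite EFinM; apply: lee_wpmul2l; first by rewrite lee_fin powR_ge0.
    apply: integral_powR_near; rewrite ?mulr_gt0//.
    - exact: measurable_jap.
    - by move=> s /andP[s0 _]; exact: lebesgue_rV_jap_le.
  rewrite ge0_integralZl_EFin; last 4 first.
  - exact: measurable_superlevel measurable_jap.
  - by move=> y _; rewrite lee_fin powR_ge0.
  - by apply/measurable_EFinP; exact: measurable_funTS.
  - exact: powR_ge0.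
  rewrite EFinM; apply: lee_wpmul2l; first by rewrite lee_fin powR_ge0.
  apply: integral_powR_far; rewrite ?mulr_gt0 ?(addr_gt0 a0 t0)//.
  - exact: measurable_jap.
  - by move=> s Xs; apply: lebesgue_rV_jap_le; apply: lt_le_trans Xs; rewrite mulr_gt0.
rewrite -!EFinD lee_fin le_eqVlt; apply/orP; left; apply/eqP.
have zX e : ((z * X) `^ e = z `^ e * X `^ e)%R by rewrite powRM ?ltW.
have tX e : ((3 * X) `^ e = 3 `^ e * X `^ e)%R by rewrite powRM ?ltW.
rewrite !zX !tX /K1 /K2 /K3.
have XD e1 e2 : (X `^ (e1 + e2) = X `^ e1 * X `^ e2)%R.
  by rewrite powRD//; apply/implyP => _; rewrite gt_eqF.
have -> : (N - (a + t) = N - a - t)%R by ring.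
rewrite [(X `^ (N - a))%R]XD [(X `^ (N - t))%R]XD !XD.
by ring.
Qed.

End Convolution.

(** * The Riesz potential against a weight *)

Section Weighted_Riesz.
Context {R : realType} {n : nat}.
Local Notation mu := (lebesgue_rV R n).
Local Notation N := (n%:R : R).
Implicit Types (x y : 'rV[R]_n).

(** A compactly supported weight in [L^s] is handled by Young's inequality
    [w r^-A <= w^s + r^-(A s')], the second power being locally integrable.
    The factor [(1 + |y|)^-kappa] comes from the support of [w] being
    bounded. *)
Lemma integral_bounded_support_weight (w : 'rV[R]_n -> R) (A kappa s s' M : R) :
  measurable_fun [set: 'rV[R]_n] w -> (forall x, (0 <= w x)%R) ->
  (forall x, (M < `|x|)%R -> w x = 0%R) -> (0 <= M)%R ->
  (1 < s)%R -> (1 < s')%R -> (s^-1 + s'^-1 = 1)%R ->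
  (0 < A)%R -> (A * s' < N)%R -> (0 <= kappa <= A)%R ->
  \int[mu]_x (w x `^ s)%:E < +oo ->
  exists2 C : R, (0 < C)%R & forall y,
    \int[mu]_x (w x * `|x - y| `^ (- A))%:E <= (C * (1 + `|y|) `^ (- kappa))%:E.
Proof.
move=> mw w0 wM M0 s1 s'1 ss' A0 As' /andP[k0 kA] wfin.
have s0 : (0 < s)%R by exact: lt_trans s1.
have s'0 : (0 < s')%R by exact: lt_trans s'1.
pose S := fine (\int[mu]_x (w x `^ s)%:E).
have SE : \int[mu]_x (w x `^ s)%:E = S%:E.
  rewrite fineK// ge0_fin_numE//.
  by apply: integral_ge0 => x _; rewrite lee_fin powR_ge0.
have S0 : (0 <= S)%R.
  by rewrite fine_ge0//; apply: integral_ge0 => x _; rewrite lee_fin powR_ge0.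
pose K := (2 ^+ n * 1 `^ (N - A * s') * 2^-1 `^ (- (A * s'))
  / (1 - 2^-1 `^ (N - A * s')))%R.
have mws : measurable_fun [set: 'rV[R]_n] (fun x => (w x `^ s)%:E).
  by apply/measurable_EFinP; exact: measurable_funT_powR.
have mD (y : 'rV[R]_n) t : measurable [set x | (`|x - y| <= t)%R].
  by under eq_set do rewrite distrC; exact: measurable_sublevel (measurable_rV_distl y).
have mr (y : 'rV[R]_n) e : measurable_fun [set: 'rV[R]_n]
    (fun x => (`|x - y| `^ e)%:E).
  apply/measurable_EFinP; apply: measurable_funT_powR.
  by under eq_fun do rewrite distrC; exact: measurable_rV_distl.
pose L := ((2 + M) `^ kappa)%R.
have L0 : (0 < L)%R by apply: powR_gt0; rewrite ltr_wpDr.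
have K0 : (0 <= K)%R.
  rewrite /K !mulr_ge0 ?powR_ge0// invr_ge0 subr_ge0 ltW//.
  have z1 : (0 < (2^-1 : R) < 1)%R by rewrite invr_gt0 invf_lt1 ?ltr0n ?ltr1n.
  by have /(powR_lt1 z1)/andP[] : (0 < N - A * s')%R by rewrite subr_gt0.
exists (L * ((S + K) + ((2 * M) ^+ n + S)) + 1)%R.
  by rewrite ltr_wpDl// mulr_ge0 ?(ltW L0)// !addr_ge0// exprn_ge0// mulr_ge0.
move=> y; set J := ((1 + `|y|) `^ (- kappa))%R.
have y0 : (0 < 1 + `|y|)%R by rewrite ltr_pwDl.
have J0 : (0 < J)%R by rewrite powR_gt0.
have -> : \int[mu]_x (w x * `|x - y| `^ (- A))%:E =
    \int[mu]_(x in [set x | (`|x - 0| <= M)%R]) (w x * `|x - y| `^ (- A))%:E.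
  rewrite [RHS]integral_mkcond; apply: eq_integral => x _; rewrite patchE.
  case: ifPn => //; rewrite notin_setE/= subr0 => /negP; rewrite -ltNge => /wM ->.
  by rewrite mul0r.
apply: (@le_trans _ _ (
  \int[mu]_(x in [set x | (`|x - y| <= 1)%R])
     ((L * J)%:E * ((w x `^ s)%:E + (`|x - y| `^ (- (A * s')))%:E)) +
  \int[mu]_(x in [set x | (`|x - 0| <= M)%R])
     ((L * J)%:E * (1%:E + (w x `^ s)%:E)))).
  apply: le_integral_cover2 => //.
  - by apply: measurable_funeM; apply: emeasurable_funD.
  - by apply: measurable_funeM; apply: emeasurable_funD.
  - by move=> x; rewrite mule_ge0 ?adde_ge0// lee_fin ?mulr_ge0 ?powR_ge0 ?ltW.
  - by move=> x; rewrite mule_ge0 ?adde_ge0// lee_fin ?mulr_ge0 ?powR_ge0 ?ltW.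
  - by move=> x _; rewrite lee_fin mulr_ge0 ?powR_ge0.
  move=> x; rewrite /= subr0 => xM.
  have tri : (1 + `|y| <= 1 + M + `|x - y|)%R.
    have := ler_normB x (x - y)%R; rewrite opprB addrC subrK; lra.
  (* applied with c = 1 close to y and with c = |x - y| away from y *)
  have J1 c : (1 + `|y| <= (2 + M) * c)%R -> (0 < c)%R -> (c `^ (- kappa) <= L * J)%R.
    move=> yc c0; have M2 : (0 < 2 + M)%R by rewrite ltr_wpDr.
    have -> : (L * J = ((1 + `|y|) / (2 + M)) `^ (- kappa))%R.
      rewrite powRM ?invr_ge0 ?(ltW M2) ?(ltW y0)// mulrC; congr (_ * _)%R.
      by rewrite -(powR_inv1 (ltW M2)) -powRrM mulN1r opprK.
    apply: ler_powRN => //; first by rewrite divr_gt0.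
    by rewrite ler_pdivrMr// mulrC.
  have [xy|xy] := leP (`|x - y|)%R 1%R; [left|right]; split=> //.
    rewrite -EFinD -EFinM lee_fin.
    apply: (@le_trans _ _ (1 * (w x `^ s + `|x - y| `^ (- (A * s'))))%R); last first.
      rewrite ler_wpM2r ?addr_ge0 ?powR_ge0//.
      by have := J1 1%R _ ltr01; rewrite powR1; apply; lra.
    rewrite mul1r; apply: (le_trans (conjugate_powR (w0 x) (powR_ge0 _ _) s0 s'0 ss')).
    rewrite -powRrM mulNr lerD// ler_pdivrMr// ler_peMr ?powR_ge0// ltW//.
  rewrite -EFinD -EFinM lee_fin mulrC; apply: ler_pM; rewrite ?powR_ge0//.
    apply: (@le_trans _ _ (`|x - y| `^ (- kappa))%R).
      by apply: ler_powR; [exact: ltW|rewrite lerN2].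
    apply: J1; last exact: lt_trans xy.
    by nra.
  have [wx|wx] := leP (w x) 1%R; first by rewrite ler_wpDr ?powR_ge0.
  by rewrite ler_wpDl//; apply: le1r_powR; exact: ltW.
have LJ : (0 <= L * J)%R by rewrite mulr_ge0 ?ltW.
have dle (D : set 'rV[R]_n) : measurable D ->
    \int[mu]_(x in D) (w x `^ s)%:E <= S%:E.
  move=> mDD; rewrite -SE; apply: ge0_subset_integral => //.
  by move=> x _; rewrite lee_fin powR_ge0.
rewrite !ge0_integralZl_EFin//; last 4 first.
- by move=> x _; rewrite adde_ge0// lee_fin powR_ge0.
- by apply: measurable_funTS; apply: emeasurable_funD.
- by move=> x _; rewrite adde_ge0// lee_fin powR_ge0.
- by apply: measurable_funTS; apply: emeasurable_funD.
rewrite !ge0_integralD//; try exact: measurable_funTS;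
  try (by move=> x _; rewrite lee_fin ?powR_ge0).
apply: (@le_trans _ _ ((L * J)%:E * (S%:E + K%:E)
    + (L * J)%:E * (((2 * M) ^+ n)%:E + S%:E))).
  apply: leeD; apply: lee_wpmul2l; rewrite ?lee_fin//; apply: leeD; rewrite ?dle//.
    under eq_integral do rewrite distrC.
    rewrite [X in integral _ X _](_ : _ = [set x | (`|y - x| <= 1)%R]); last first.
      by apply/seteqP; split => x /=; rewrite distrC.
    by apply: integral_dist_powR_near; rewrite // mulr_gt0.
  rewrite integral_cst//= mul1e [X in mu X](_ : _ = [set x | (`|0 - x| <= M)%R]).
    by rewrite lebesgue_rV_ball.
  by apply/seteqP; split => x /=; rewrite distrC.
rewrite -!(EFinD, EFinM) lee_fin.
have -> : (L * J * (S + K) + L * J * ((2 * M) ^+ n + S) =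
   L * (S + K + ((2 * M) ^+ n + S)) * J)%R by ring.
by rewrite ler_wpM2r ?(ltW J0)// lerDl.
Qed.

End Weighted_Riesz.

Section Weighted_Riesz_inequality.
Context {R : realType} {n : nat}.
Local Notation mu := (lebesgue_rV R n).
Local Notation N := (n%:R : R).
Implicit Types (x y : 'rV[R]_n).

(** The Schur test with [k1 = |x - y|^-A], [k2 = |x - y|^-B] and test function
    [(1 + |y|)^(rho / p')].  Splitting the kernel so that [A] is slightly above
    [n - b] and [B] slightly below [n] (by [eta] and [eta p' / q]) makes both
    kernels locally integrable, the first one even against the [L^s] weight
    because [s b > n]; at infinity every power count is scale invariant. *)
Lemma weighted_Riesz_potential (p q b s K M : R) (w : 'rV[R]_n -> R) :
  (1 < p)%R -> (p < N)%R -> (p <= q)%R -> (0 < b)%R ->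
  (b = N - q / p * (N - p))%R ->
  measurable_fun [set: 'rV[R]_n] w -> (forall x, (0 <= w x)%R) ->
  (forall x, (M < `|x|)%R -> w x = 0%R) -> (0 <= M)%R -> (0 <= K)%R ->
  (N < s * b)%R -> \int[mu]_x (w x `^ s)%:E < +oo ->
  exists2 C : R, (0 < C)%R & forall f : 'rV[R]_n -> R,
    measurable_fun [set: 'rV[R]_n] f -> (forall y, (0 <= f y)%R) ->
  \int[mu]_x ((\int[mu]_y (`|x - y| `^ (- (N - 1)) * f y)%:E) `^ q
              * (w x + K * (1 + `|x|) `^ (- b))%:E)
  <= C%:E * (\int[mu]_y (f y `^ p)%:E) `^ (q / p).
Proof.
move=> p1 pN pq b0 bE mw w0 wM M0 K0 sb wfin.
have p0 : (0 < p)%R by exact: lt_trans p1.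
have q0 : (0 < q)%R by exact: lt_le_trans pq.
have N0 : (0 < N)%R by exact: lt_trans pN.
have N1 : (1 < N)%R by exact: lt_trans pN.
pose p' := (p / (p - 1))%R.
have pm1 : (0 < p - 1)%R by rewrite subr_gt0.
have p'0 : (0 < p')%R by rewrite divr_gt0.
have pp' : (p^-1 + p'^-1 = 1)%R by rewrite /p'; field; rewrite !gt_eqF.
have bp : (b <= p)%R.
  rewrite bE lerBlDr addrC -lerBlDr ler_peMl ?subr_ge0 ?(ltW pN)//.
  by rewrite ler_pdivlMr// mul1r.
have bN : (b < N)%R by exact: le_lt_trans pN.
have s1 : (1 < s)%R.
  by rewrite -(ltr_pM2r b0) mul1r; exact: lt_trans sb.
have s0 : (0 < s)%R by exact: lt_trans s1.
pose s' := (s / (s - 1))%R.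
have sm1 : (0 < s - 1)%R by rewrite subr_gt0.
have ss' : (s^-1 + s'^-1 = 1)%R by rewrite /s'; field; rewrite !gt_eqF.
have s'1 : (1 < s')%R by rewrite /s' ltr_pdivlMr// mul1r; lra.
have Nb0 : (0 < N - b)%R by rewrite subr_gt0.
have Nqp0 : (0 < N * q / p')%R by exact: divr_gt0 (mulr_gt0 N0 q0) p'0.
(* kappa is the exponent rho q / p' of the test function raised to q *)
pose kappa := (Num.min (N * q / p') (N - b) / 2)%R.
have kappa0 : (0 < kappa)%R.
  by rewrite /kappa divr_gt0// lt_min Nqp0 Nb0.
have kappaN : (kappa < N * q / p')%R.
  apply: (@lt_le_trans _ _ (Num.min (N * q / p') (N - b))%R); last first.
    by rewrite ge_min lexx.
  by rewrite /kappa gtr_pMr ?invf_lt1 ?ltr1n// lt_min Nqp0 Nb0.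
have kappab : (kappa < N - b)%R.
  apply: (@lt_le_trans _ _ (Num.min (N * q / p') (N - b))%R); last first.
    by rewrite ge_min lexx orbT.
  by rewrite /kappa gtr_pMr ?invf_lt1 ?ltr1n// lt_min Nqp0 Nb0.
have bs : (0 < b - N / s)%R by rewrite subr_gt0 ltr_pdivrMr// mulrC.
pose eta := (Num.min kappa (b - N / s) / 2)%R.
have eta0 : (0 < eta)%R by rewrite /eta divr_gt0// lt_min kappa0 bs.
have etak : (eta < kappa)%R.
  apply: (@lt_le_trans _ _ (Num.min kappa (b - N / s))%R); last first.
    by rewrite ge_min lexx.
  by rewrite /eta gtr_pMr ?invf_lt1 ?ltr1n// lt_min kappa0 bs.
have etas : (eta < b - N / s)%R.
  apply: (@lt_le_trans _ _ (Num.min kappa (b - N / s))%R); last first.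
    by rewrite ge_min lexx orbT.
  by rewrite /eta gtr_pMr ?invf_lt1 ?ltr1n// lt_min kappa0 bs.
pose A := (N - b + eta)%R.
pose B := (N - eta * p' / q)%R.
pose rho := (kappa * p' / q)%R.
have A0 : (0 < A)%R by rewrite addr_gt0.
have Ns0 : (0 < N / s)%R by rewrite divr_gt0.
have AN : (A < N)%R by rewrite /A; lra.
have As' : (A * s' < N)%R.
  rewrite /s' mulrA ltr_pdivrMr//.
  have : ((N - b + eta) * s < (N - N / s) * s)%R by rewrite ltr_pM2r//; lra.
  by rewrite mulrBl divfK ?gt_eqF// /A; lra.
have pq0 : (0 < p' / q)%R by rewrite divr_gt0.
have rho0 : (0 < rho)%R by rewrite /rho -mulrA; exact: mulr_gt0.
have rhoN : (rho < N)%R.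
  by move: kappaN; rewrite ltr_pdivlMr// /rho ltr_pdivrMr.
have etarho : (eta * p' / q < rho)%R by rewrite /rho ltr_pM2r ?invr_gt0// ltr_pM2r.
have B0 : (0 < B)%R by rewrite /B; lra.
have BN : (B < N)%R by rewrite /B gtrBl -mulrA; exact: mulr_gt0.
have Brho : (N < B + rho)%R by rewrite /B; lra.
have [C1 C10 HC1] := @convolution_powR R n B rho
  (introT andP (conj B0 BN)) (introT andP (conj rho0 rhoN)) Brho.
pose t := (b + kappa - eta)%R.
have t0 : (0 < t)%R by rewrite /t; lra.
have tN : (t < N)%R by rewrite /t; lra.
have At : (N < A + t)%R by rewrite /A /t; lra.
have [C2 C20 HC2] := @convolution_powR R n A t
  (introT andP (conj A0 AN)) (introT andP (conj t0 tN)) At.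
have kA : (0 <= kappa <= A)%R by rewrite (ltW kappa0)/= /A; lra.
have [C3 C30 HC3] := integral_bounded_support_weight mw w0 wM M0 s1 s'1 ss' A0
  As' kA wfin.
pose v x := (C1 * (1 + `|x|) `^ (N - B - rho))%R.
pose phi y := ((1 + `|y : 'rV[R]_n|) `^ (rho / p'))%R.
pose k1 (z : 'rV[R]_n * 'rV[R]_n) := (`|z.1 - z.2| `^ (- A))%R.
pose k2 (z : 'rV[R]_n * 'rV[R]_n) := (`|z.1 - z.2| `^ (- B))%R.
pose W x := (w x + K * (1 + `|x : 'rV[R]_n|) `^ (- b))%R.
have j0 x : (0 < 1 + `|x|)%R by rewrite ltr_pwDl.
have mj e : measurable_fun [set: 'rV[R]_n] (fun y => (1 + `|y|) `^ e)%R.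
  by apply: measurable_funT_powR; exact: measurable_jap.
have mk e : measurable_fun [set: 'rV[R]_n * 'rV[R]_n]
    (fun z => `|z.1 - z.2| `^ e)%R.
  by apply: measurable_funT_powR; exact: measurable_rV_dist.
have mW : measurable_fun [set: 'rV[R]_n] W.
  by apply: measurable_funD => //; exact: measurable_funM.
have W0 x : (0 <= W x)%R by rewrite addr_ge0// mulr_ge0// powR_ge0.
have Hv x : \int[mu]_y (k2 (x, y) * phi y `^ (- p'))%:E <= (v x)%:E.
  apply: le_trans (HC1 x); rewrite le_eqVlt; apply/orP; left; apply/eqP.
  apply: eq_integral => y _; congr ((_ * _)%:E).
  by rewrite /phi -powRrM mulrN divfK// gt_eqF.
pose C := (C1 `^ (q / p') * (C3 + K * C2))%R.
have C0 : (0 < C)%R.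
  apply: mulr_gt0; first exact: powR_gt0.
  by apply: ltr_wpDr => //; apply: mulr_ge0 => //; exact: ltW.
have Hw y : \int[mu]_x (W x * v x `^ (q / p') * k1 (x, y))%:E
    <= (C * phi y `^ (- q))%:E.
  have -> : (phi y `^ (- q) = (1 + `|y|) `^ (- kappa))%R.
    rewrite /phi -powRrM; congr (_ `^ _)%R.
    by rewrite /rho; field; rewrite !gt_eqF.
  apply: (@le_trans _ _ (\int[mu]_x ((C1 `^ (q / p'))%:E *
      ((w x * `|x - y| `^ (- A))%:E +
       K%:E * (`|y - x| `^ (- A) * (1 + `|x|) `^ (- t))%:E)))).
    apply: le_integral_ge0 => x _.
      by rewrite lee_fin !mulr_ge0 ?powR_ge0.
    have -> : (v x `^ (q / p') = C1 `^ (q / p') * (1 + `|x|) `^ (eta - kappa))%R.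
      rewrite /v powRM ?powR_ge0 ?(ltW C10)// -powRrM; congr (_ * _ `^ _)%R.
      by rewrite /B /rho; field; rewrite !gt_eqF.
    rewrite -!(EFinM, EFinD) lee_fin.
    rewrite [X in (X <= _)%R](_ : _ = (C1 `^ (q / p') * ((W x *
      (1 + `|x|) `^ (eta - kappa)) * `|x - y| `^ (- A))))%R; last first.
      by rewrite /k1 /=; ring.
    rewrite ler_wpM2l ?powR_ge0//.
    have jd : ((1 + `|x|) `^ (eta - kappa) <= 1)%R.
      have := @ler_powRN R (kappa - eta)%R 1%R (1 + `|x|)%R.
      by rewrite powR1 opprB; apply; rewrite ?subr_ge0 ?(ltW etak) ?lerDl.
    have jt : ((1 + `|x|) `^ (- t) =
        (1 + `|x|) `^ (- b) * (1 + `|x|) `^ (eta - kappa))%R.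
      rewrite -powRD; last by apply/implyP => _; rewrite gt_eqF.
      by congr (_ `^ _)%R; rewrite /t; ring.
    rewrite jt (distrC y) /W mulrDl mulrDl lerD//.
      by rewrite ler_wpM2r ?powR_ge0// ler_piMr.
    by rewrite le_eqVlt; apply/orP; left; apply/eqP; ring.
  have m1 e : measurable_fun [set: 'rV[R]_n] (fun x => `|x - y| `^ e)%R.
    apply: measurable_funT_powR.
    by under eq_fun do rewrite distrC; exact: measurable_rV_distl.
  have m2 : measurable_fun [set: 'rV[R]_n] (fun x => (w x * `|x - y| `^ (- A))%:E).
    by apply/measurable_EFinP; exact: measurable_funM.
  have m3 : measurable_fun [set: 'rV[R]_n]
      (fun x => (`|y - x| `^ (- A) * (1 + `|x|) `^ (- t))%:E).
    apply/measurable_EFinP; apply: measurable_funM => //.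
    by apply: measurable_funT_powR; exact: measurable_rV_distl.
  have p2 x : 0 <= (w x * `|x - y| `^ (- A))%:E.
    by rewrite lee_fin mulr_ge0 ?powR_ge0.
  have p3 x : 0 <= (`|y - x| `^ (- A) * (1 + `|x|) `^ (- t))%:E.
    by rewrite lee_fin mulr_ge0 ?powR_ge0.
  have m4 : measurable_fun [set: 'rV[R]_n] (fun x => K%:E *
      (`|y - x| `^ (- A) * (1 + `|x|) `^ (- t))%:E) by exact: measurable_funeM.
  have p4 x : 0 <= K%:E * (`|y - x| `^ (- A) * (1 + `|x|) `^ (- t))%:E.
    by rewrite mule_ge0.
  rewrite ge0_integralZl_EFin ?powR_ge0//; last 2 first.
  - by move=> x _; rewrite adde_ge0.
  - exact: emeasurable_funD.
  rewrite ge0_integralD// ge0_integralZl_EFin//.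
  rewrite /C -mulrA EFinM lee_wpmul2l ?lee_fin ?powR_ge0// mulrDl EFinD leeD//.
  rewrite -mulrA EFinM lee_wpmul2l ?lee_fin//; apply: le_trans (HC2 y) _.
  rewrite lee_fin le_eqVlt; apply/orP; left; apply/eqP; congr (_ * _ `^ _)%R.
  by rewrite /A /t; ring.
have := @schur_test _ _ _ _ R mu mu k1 k2 phi v W p p' q C p0 p'0 pp' pq C0.
move=> /(_ (mk _) (mk _) _ _ mW) H.
exists C => // f mf f0; apply: le_trans (H _ _ _ _ _ _ _ Hv Hw _ mf f0) => //.
- rewrite le_eqVlt; apply/orP; left; apply/eqP; apply: eq_integral => x _.
  congr (_ `^ _ * _); apply: eq_integral => y _; congr ((_ * _)%:E).
  rewrite /k1 /k2 /= -!powRrM.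
  have E : (- A * q^-1 + - B * p'^-1 = - (N - 1))%R.
    by rewrite /A /B bE /p'; field; rewrite !gt_eqF.
  rewrite -powRD E//; apply/implyP; rewrite oppr_eq0 subr_eq0.
  by rewrite gt_eqF.
- exact: mj.
- by apply: measurable_funM => //; exact: mj.
- by move=> z; exact: powR_ge0.
- by move=> z; exact: powR_ge0.
- by move=> y; exact: powR_gt0.
- by move=> x; rewrite mulr_ge0 ?powR_ge0 ?ltW.
Qed.

End Weighted_Riesz_inequality.

(** * Distance to a bounded set and Minkowski dimension *)

Section Distance.
Context {R : realType} {n : nat}.
Local Notation mu := (lebesgue_rV R n).
Local Notation N := (n%:R : R).
Implicit Types (x y v : 'rV[R]_n) (E : set 'rV[R]_n).

Lemma enorm_ge0 v : (0 <= enorm v)%R.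
Proof. exact: sqrtr_ge0. Qed.

Lemma norm_le_enorm v : (`|v| <= enorm v)%R.
Proof.
apply/rV_norm_leP; first exact: enorm_ge0.
move=> i; rewrite -sqrtr_sqr /enorm ler_sqrt ?sumr_ge0//; last first.
  by move=> j _; exact: sqr_ge0.
by rewrite (bigD1 i)//= lerDl sumr_ge0// => j _; exact: sqr_ge0.
Qed.

Lemma continuous_sqrt_sum_sqr (g : 'I_n -> 'rV[R]_n -> R) :
  (forall i, continuous (g i)) ->
  continuous (fun v => Num.sqrt (\sum_(i < n) g i v ^+ 2))%R.
Proof.
move=> cg; have cs (s : seq 'I_n) :
    continuous (fun v : 'rV[R]_n => \sum_(i <- s) g i v ^+ 2)%R.
  elim: s => [|i s IH].
    rewrite (_ : (fun v => _) = fun=> 0%R); first exact: cst_continuous.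
    by apply/funext => u; rewrite big_nil.
  rewrite (_ : (fun v => _) =
    (fun u : 'rV[R]_n => g i u * g i u + \sum_(j <- s) g j u ^+ 2)%R); last first.
    by apply/funext => u; rewrite big_cons expr2.
  move=> v; apply: continuousD (IH v); exact: continuousM (cg i v) (cg i v).
move=> v; apply: continuous_comp; [exact: cs|exact: sqrt_continuous].
Qed.

Lemma continuous_enorm : continuous (@enorm R n).
Proof.
apply: (continuous_sqrt_sum_sqr (g := fun i v => v ord0 i)) => i.
by move=> u; exact: coord_continuous.
Qed.

Lemma edist_ge0 x E : (0 <= edist x E)%R.
Proof.
have [->|E0] := eqVneq E set0.
  by rewrite /edist image_set0 inf0.
apply: lb_le_inf; first by apply/image_nonempty/set0P.
by move=> _ [y _ <-]; exact: enorm_ge0.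
Qed.

Lemma edist_ltP x E (s : R) : E !=set0 ->
  (edist x E < s)%R <-> exists2 y, E y & (enorm (x - y) < s)%R.
Proof.
move=> E0; split.
  have : [set enorm (x - y) | y in E] !=set0 by apply/image_nonempty.
  by move=> /inf_lt/[apply] -[_ [y Ey <-] ys]; exists y.
move=> [y Ey]; apply: le_lt_trans; apply: ge_inf; last by exists y.
by exists 0%R => _ [z _ <-]; exact: enorm_ge0.
Qed.

Lemma measurable_edist E : E !=set0 ->
  measurable_fun [set: 'rV[R]_n] (fun x => edist x E).
Proof.
move=> E0; apply: (measurability _ (RGenInftyO.measurableE R)).
move=> _ [_ [s ->] <-]; rewrite setTI; apply: open_measurable_rV.
rewrite (_ : _ @^-1` _ = \bigcup_(y in E)
    ((fun x => enorm (x - y)) @^-1` `]-oo, s[%classic)); last first.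
  apply/seteqP; split=> x /=; rewrite in_itv/=.
    by move=> /(edist_ltP _ _ E0)[y Ey xy]; exists y => //=; rewrite in_itv.
  by move=> [y Ey /=]; rewrite in_itv/= => xy; apply/(edist_ltP _ _ E0); exists y.
apply: bigcup_open => y Ey; apply: open_comp; last exact: interval_open.
move=> x _; apply: (@continuous_comp _ _ _ (fun x : 'rV[R]_n => x - y)%R).
  by apply: (@continuousB _ _ _ id (cst y)); [exact: cvg_id|exact: cst_continuous].
exact: continuous_enorm.
Qed.

Lemma ediam_bounded E : E !=set0 -> ediam E < +oo ->
  exists2 M : R, (0 <= M)%R & forall y, E y -> (`|y| <= M)%R.
Proof.
move=> [y0 Ey0] dE.
have d0 : 0 <= ediam E.
  by apply: ereal_sup_ubound; exists y0, y0; split => //; rewrite subrr /enorm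
    big1 ?sqrtr0// => i _; rewrite mxE expr0n.
have dfin : ediam E \is a fin_num by rewrite ge0_fin_numE.
exists (`|y0| + fine (ediam E))%R; first by rewrite addr_ge0// fine_ge0.
move=> y Ey; rewrite -[y in (`|y|)%R](subrK y0) addrC.
rewrite (le_trans (ler_normD _ _))// lerD2l (le_trans (norm_le_enorm _))//.
by rewrite -lee_fin fineK//; apply: ereal_sup_ubound; exists y, y0.
Qed.

Lemma edist_le_norm x E (M s : R) : E !=set0 ->
  (forall y, E y -> (`|y| <= M)%R) -> (edist x E <= s)%R -> (`|x| <= M + s)%R.
Proof.
move=> E0 EM xs; apply/ler_addgt0Pr => e e0.
have /(edist_ltP _ _ E0)[y Ey xy] : (edist x E < s + e)%R by lra.
rewrite -[x in (`|x|)%R](subrK y).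
have := ler_normD (x - y)%R y; have := EM _ Ey; have := norm_le_enorm (x - y)%R.
lra.
Qed.

Lemma covering_number_lt E (r : R) (delta : R) : covering_number E delta < r%:E ->
  exists k (c : 'I_k -> 'rV[R]_n), (k%:R < r)%R /\
    forall y, E y -> exists i, (enorm (y - c i) <= delta)%R.
Proof.
move=> /ereal_inf_lt[_ [k [c Ec] <-]]; rewrite lte_fin => kr.
by exists k, c; split => // y /Ec [i _]; exists i.
Qed.

(** If balls of radius [delta] cover [E], the balls with the same centers and
    radius [3 delta] cover the points at distance at most [delta] from [E]. *)
Lemma lebesgue_edist_le E (r delta : R) : E !=set0 -> (0 < delta)%R ->
  covering_number E delta < r%:E ->
  mu [set x | (edist x E <= delta)%R] <= (r * (6 * delta) ^+ n)%:E.
Proof.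
move=> E0 d0 /covering_number_lt[k [c [kr Ec]]].
pose A (j : nat) : set 'rV[R]_n := if insub j is Some i
  then [set x | (`|c i - x| <= 3 * delta)%R] else set0.
have mA j : measurable (A j).
  rewrite /A; case: insub => [i|]; last exact: measurable0.
  exact: measurable_sublevel (measurable_rV_distl (c i)).
have mE : measurable [set x | (edist x E <= delta)%R].
  exact: measurable_sublevel (measurable_edist E0).
apply: (@le_trans _ _ (\sum_(i < k) mu (A i))).
  apply: content_subadditive => // x /= xE.
  have /(edist_ltP _ _ E0)[y Ey xy] : (edist x E < 2 * delta)%R by lra.
  have [i yi] := Ec _ Ey; rewrite -bigcup_mkord; exists (val i) => /=; first exact: ltn_ord.
  rewrite /A valK /= distrC.
  have := norm_le_enorm (x - y)%R; have := norm_le_enorm (y - c i)%R.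
  have := ler_normD (x - y)%R (y - c i)%R; rewrite addrA subrK; lra.
apply: (@le_trans _ _ (\sum_(i < k) ((6 * delta) ^+ n)%:E)).
  apply: lee_sum => i _; rewrite /A valK lebesgue_rV_ball; last first.
    by rewrite mulr_ge0// ltW.
  by rewrite lee_fin mulrA -natrM.
rewrite sumEFin lee_fin sumr_const card_ord -[X in (X <= _)%R]mulr_natl ler_wpM2r ?(ltW kr)//.
by rewrite exprn_ge0// mulr_ge0// ltW.
Qed.

(** For [delta < 1] the logarithm of [1 / delta] is positive, so a bound on the
    quotient of logarithms is a bound on the covering number. *)
Lemma upper_Minkowski_dim_lt E (D : R) : upper_Minkowski_dim E < D%:E ->
  exists2 d0 : R, (0 < d0)%R & forall delta, (0 < delta < d0)%R ->
    covering_number E delta < (delta `^ (- D))%:E.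
Proof.
move=> /ereal_inf_lt[_ [V + <-] supV].
rewrite /nbhs /= /at_right /within /= => /nbhs_ballP[e /= e0 eV].
exists (Num.min e 1%R); first by rewrite lt_min e0 ltr01.
move=> delta /andP[d0]; rewrite lt_min => /andP[de d1].
have Vd : V delta.
  by apply: eV => //=; rewrite /ball/= sub0r normrN gtr0_norm.
have ln0 : (0 < ln delta^-1)%R by rewrite ln_gt0// invf_gt1.
have lnN : (ln delta^-1 = - ln delta)%R by rewrite lnV.
have /= := le_lt_trans (ereal_sup_ubound _) supV.
move=> /(_ _ (ex_intro2 _ _ delta Vd erefl)); rewrite !ltNge; apply: contra => H.
have : lne (delta `^ (- D))%:E <= lne (covering_number E delta).
  rewrite lee_lne// in_itv/= leey andbT.
    by rewrite lee_fin powR_ge0.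
  by apply: le_ereal_inf_tmp => _ [k _ <-]; rewrite lee_fin.
rewrite lne_EFin ?powR_gt0// ln_powR mulNr -mulrN -lnN => H1.
apply: (le_trans _ (lee_wpmul2r _ H1)); last by rewrite lee_fin invr_ge0 ltW.
by rewrite -EFinM mulfK// gt_eqF.
Qed.

End Distance.

Section Hardy_Sobolev_weight.
Context {R : realType} {n : nat}.
Local Notation mu := (lebesgue_rV R n).
Local Notation N := (n%:R : R).
Implicit Types (x y : 'rV[R]_n).
Variables (E : set 'rV[R]_n) (M D : R).
Hypotheses (E0 : E !=set0) (M0 : (0 <= M)%R).
Hypothesis EM : forall y, E y -> (`|y| <= M)%R.
Hypothesis dimE : upper_Minkowski_dim E < D%:E.
Hypothesis DN : (D < N)%R.

Lemma measurable_edist_le (s : R) : measurable [set x | (edist x E <= s)%R].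
Proof. exact: measurable_sublevel (measurable_edist E0). Qed.

(** At scales below some [d0] this is the covering bound; the remaining scales
    are absorbed in the constant because [E] is bounded. *)
Lemma lebesgue_tubular : exists2 C : R, (0 < C)%R & forall s, (0 < s <= 1)%R ->
  mu [set x | (edist x E <= s)%R] <= (C * s `^ (N - D))%:E.
Proof.
have [d0 d00 Hd] := upper_Minkowski_dim_lt dimE.
have m0 : (0 < N - D)%R by rewrite subr_gt0.
have M1 : (0 < 2 * (M + 1))%R by rewrite mulr_gt0// ltr_wpDl.
exists (6 ^+ n + (2 * (M + 1)) ^+ n * d0 `^ (- (N - D)))%R.
  by rewrite addr_gt0 ?exprn_gt0// mulr_gt0 ?exprn_gt0// powR_gt0.
move=> s /andP[s0 s1]; have [sd|ds] := ltP s d0.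
  have sd' : (0 < s < d0)%R by rewrite s0.
  apply: (le_trans (lebesgue_edist_le E0 s0 (Hd _ sd'))).
  rewrite lee_fin [leRHS]mulrDl ler_wpDr//.
    by rewrite mulr_ge0 ?powR_ge0// mulr_ge0 ?powR_ge0// exprn_ge0// ltW.
  rewrite exprMn powRD; last by apply/implyP => _; rewrite gt_eqF.
  rewrite powR_mulrn ?(ltW s0)// le_eqVlt; apply/orP; left; apply/eqP; ring.
apply: (@le_trans _ _ (mu [set x | (`|0 - x| <= M + 1)%R])).
  apply: le_measure; rewrite ?inE; [exact: measurable_edist_le| |].
    exact: measurable_sublevel (measurable_rV_distl 0%R).
  move=> x /= xs; rewrite sub0r normrN.
  by apply: (edist_le_norm E0 EM); exact: le_trans xs s1.
rewrite lebesgue_rV_ball ?addr_ge0// lee_fin [leRHS]mulrDl ler_wpDl//.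
  by rewrite mulr_ge0 ?powR_ge0// exprn_ge0.
rewrite -mulrA ler_peMr ?exprn_ge0// ?(ltW M1)//.
rewrite powRN mulrC ler_pdivlMr ?powR_gt0// mul1r.
by apply: ge0_ler_powR; rewrite ?nnegrE ?(ltW m0) ?(ltW s0) ?(ltW d00).
Qed.

Lemma integral_edist_powR (a : R) : (0 < a < N - D)%R ->
  \int[mu]_(x in [set x | (edist x E <= 1)%R]) (edist x E `^ (- a))%:E < +oo.
Proof.
move=> /andP[a0 aD]; have [C C0 HC] := lebesgue_tubular.
have := @integral_powR_near _ _ _ mu (fun x => edist x E) (N - D) C 1 a.
move=> /(_ (measurable_edist E0) (ltW C0) ltr01 a0 (fun x => edist_ge0 x E) aD HC).
by move=> /le_lt_trans; apply; rewrite ltry.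
Qed.

Lemma lebesgue_edist0 : mu [set x | (edist x E <= 0)%R] = 0.
Proof.
have [C C0 HC] := lebesgue_tubular; have m0 : (0 < N - D)%R by rewrite subr_gt0.
apply/eqP; rewrite eq_le measure_ge0 andbT; apply/lee_addgt0Pr => e e0.
rewrite add0e; pose s := (Num.min 1 ((e / C) `^ (N - D)^-1))%R.
have s0 : (0 < s)%R by rewrite lt_min ltr01 powR_gt0// divr_gt0.
apply: (@le_trans _ _ (mu [set x | (edist x E <= s)%R])).
  apply: le_measure; rewrite ?inE; try exact: measurable_edist_le.
  by move=> x /= /le_trans; apply; exact: ltW.
apply: (le_trans (HC s _)); first by rewrite s0 ge_min lexx.
rewrite lee_fin mulrC -ler_pdivlMr//.
have -> : (e / C = ((e / C) `^ (N - D)^-1) `^ (N - D))%R.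
  by rewrite -powRrM mulVf ?gt_eqF// powRr1// ltW// divr_gt0.
apply: ge0_ler_powR; rewrite ?nnegrE ?(ltW m0) ?(ltW s0) ?powR_ge0//.
by rewrite ge_min lexx orbT.
Qed.

(** The part of the weight that is singular along [E]; for [g > 0] it takes the
    value [0] on [E] itself, which is harmless on a null set. *)
Definition near_weight (g : R) x : R :=
  (edist x E `^ (- g) * \1_[set x | (edist x E <= 1)%R] x)%R.

Lemma measurable_near_weight g :
  measurable_fun [set: 'rV[R]_n] (near_weight g).
Proof.
apply: measurable_funM; first by apply: measurable_funT_powR; exact: measurable_edist.
by apply: measurable_indic; exact: measurable_edist_le.
Qed.

Lemma near_weight_ge0 g x : (0 <= near_weight g x)%R.
Proof. by rewrite mulr_ge0 ?powR_ge0. Qed.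

Lemma near_weight_support g x : (M + 1 < `|x|)%R -> near_weight g x = 0%R.
Proof.
move=> Mx; rewrite /near_weight indicE memNset ?mulr0//= => x1.
by have := edist_le_norm E0 EM x1; lra.
Qed.

Lemma near_weight_integrable g s : (0 < g)%R -> (0 < s)%R -> (s * g < N - D)%R ->
  \int[mu]_x (near_weight g x `^ s)%:E < +oo.
Proof.
move=> g0 s0 sg; have := @integral_edist_powR (s * g).
rewrite mulr_gt0// sg => /(_ isT); apply: le_lt_trans.
rewrite le_eqVlt; apply/orP; left; apply/eqP.
rewrite [RHS]integral_mkcond; apply: eq_integral => x _.
rewrite patchE /near_weight indicE.
case: ifPn => _; last by rewrite mulr0 powR0// gt_eqF.
by rewrite mulr1 -powRrM mulNr mulrC.
Qed.

(** Up to distance 1 from [E] the first power is kept; beyond, [1 + |x|] is at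
    most [2 + M] times the distance because [E] lies in the ball of radius
    [M]. *)
Lemma HS_weight_le g b x : (0 <= b)%R -> (0 < edist x E)%R ->
  HS_weight E (- g)%R (- b)%R x <=
  (near_weight g x + (2 + M) `^ b * (1 + `|x|) `^ (- b))%:E.
Proof.
move=> b0 d0; rewrite /HS_weight; have M2 : (0 < 2 + M)%R by rewrite ltr_wpDr.
have [d1|d1] := leP (edist x E) 1%R.
  rewrite ge_min; apply/orP; left; rewrite edist_pow_gt0// lee_fin.
  by rewrite /near_weight indicE mem_set// mulr1 lerDl mulr_ge0 ?powR_ge0.
rewrite ge_min; apply/orP; right; rewrite edist_pow_gt0// lee_fin.
rewrite ler_wpDl ?near_weight_ge0//.
have -> : ((2 + M) `^ b * (1 + `|x|) `^ (- b) = ((1 + `|x|) / (2 + M)) `^ (- b))%R.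
  rewrite powRM ?invr_ge0 ?(ltW M2) ?addr_ge0// mulrC; congr (_ * _)%R.
  by rewrite -(powR_inv1 (ltW M2)) -powRrM mulN1r opprK.
apply: ler_powRN => //; first by rewrite divr_gt0// ltr_pwDl.
rewrite ler_pdivrMr//; have := edist_le_norm E0 EM (lexx (edist x E)).
have : (0 <= (edist x E - 1) * M)%R by rewrite mulr_ge0 ?subr_ge0 ?(ltW d1).
rewrite mulrBl mul1r mulrDr; move: d1; set e := edist x E; lra.
Qed.

Lemma integral_HS_weight_le g b (u : 'rV[R]_n -> \bar R) : (0 <= b)%R ->
  measurable_fun [set: 'rV[R]_n] u -> (forall x, 0 <= u x) ->
  \int[mu]_x (u x * HS_weight E (- g)%R (- b)%R x) <=
  \int[mu]_x (u x * (near_weight g x + (2 + M) `^ b * (1 + `|x|) `^ (- b))%:E).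
Proof.
move=> b0 mu_ u0.
have HS0 x : 0 <= HS_weight E (- g)%R (- b)%R x.
  by rewrite /HS_weight le_min !expeR_ge0.
have W0 x : 0 <= (near_weight g x + (2 + M) `^ b * (1 + `|x|) `^ (- b))%:E.
  by rewrite lee_fin addr_ge0 ?near_weight_ge0// mulr_ge0 ?powR_ge0.
rewrite -[leRHS]adde0.
have <- : \int[mu]_(x in [set x | (edist x E <= 0)%R]) +oo = 0.
  rewrite integral_cst; last exact: measurable_edist_le.
  by rewrite [X in _ * X]lebesgue_edist0 mule0.
apply: le_integral_cover2 => //.
- exact: measurable_edist_le.
- apply: emeasurable_funM => //; apply/measurable_EFinP.
  apply: measurable_funD; first exact: measurable_near_weight.
  apply: measurable_funM => //; apply: measurable_funT_powR; exact: measurable_jap.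
- by move=> x; rewrite mule_ge0.
- by move=> x _; rewrite mule_ge0.
move=> x _; have [d0|d0] := leP (edist x E) 0%R; [right|left].
  by rewrite leey.
by split => //; rewrite lee_wpmul2l// HS_weight_le.
Qed.

End Hardy_Sobolev_weight.

Section Riesz_Hardy_Sobolev.
Context {R : realType} {n : nat}.
Local Notation mu := (lebesgue_rV R n).
Local Notation N := (n%:R : R).

(** An infinite [dim] would make the left-hand side of the hypothesis [+oo]. *)
Lemma Minkowski_dim_gap (dim : \bar R) (gamma1 gamma2 : R) :
  (0 < n)%N -> (gamma1 < 0)%R -> (gamma2 < 0)%R ->
  gamma2%:E * (1 - dim * (N^-1)%:E) < gamma1%:E ->
  exists2 D : R, dim < D%:E & (D < N * (1 - gamma1 / gamma2))%R.
Proof.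
move=> n0 g1 g2; have N0 : (0 < N)%R by rewrite ltr0n.
case: dim => [r| |] /=.
- rewrite lte_fin => H.
  have rN : (r < N * (1 - gamma1 / gamma2))%R.
    have H1 : (gamma1 / gamma2 < 1 - r / N)%R by rewrite ltr_ndivrMr// mulrC.
    rewrite mulrC -ltr_pdivrMr//; lra.
  by exists ((r + N * (1 - gamma1 / gamma2)) / 2)%R;
    [rewrite lte_fin midf_lt|rewrite midf_lt].
- rewrite gt0_mulye ?lte_fin ?invr_gt0//= lt0_muleNy ?lte_fin//.
- move=> _; exists (N * (1 - gamma1 / gamma2) - 1)%R; first exact: ltNyr.
  by rewrite ltrBlDr ltrDl.
Qed.

(** The upper Minkowski dimension enters through a real [D] above it with
    [n / |gamma2| < (n - D) / |gamma1|]: for [s] strictly between these two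
    numbers, [d(., E)^gamma1] is in [L^s] near [E], and [s |gamma2| > n]. *)
Lemma Riesz_potential_HS_weight (p q : R) (E : set 'rV[R]_n) (gamma1 gamma2 : R) :
  (1 < p)%R -> (p < N)%R -> (p <= q)%R -> E !=set0 -> ediam E < +oo ->
  (gamma1 < 0)%R -> (gamma2 < 0)%R ->
  gamma2%:E * (1 - upper_Minkowski_dim E * (N^-1)%:E) < gamma1%:E ->
  gamma2 = (q / p * (N - p) - N)%R ->
  exists2 C : R, (0 < C)%R & forall f : 'rV[R]_n -> R,
    measurable_fun [set: 'rV[R]_n] f -> (forall y, (0 <= f y)%R) ->
  \int[mu]_x ((\int[mu]_y (`|x - y| `^ (- (N - 1)) * f y)%:E) `^ q
              * HS_weight E gamma1 gamma2 x)
  <= C%:E * (\int[mu]_y (f y `^ p)%:E) `^ (q / p).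
Proof.
move=> p1 pN pq E0 Ebd g10 g20 gap g2E.
have N0 : (0 < N)%R by apply: lt_trans pN; exact: lt_trans p1.
have n0 : (0 < n)%N by rewrite -(@ltr0n R).
have [D dimD DN] := Minkowski_dim_gap n0 g10 g20 gap.
have [M M0 EM] := ediam_bounded E0 Ebd.
pose g := (- gamma1)%R; pose b := (- gamma2)%R.
have g0 : (0 < g)%R by rewrite oppr_gt0.
have b0 : (0 < b)%R by rewrite oppr_gt0.
have gb : (gamma1 / gamma2 = g / b)%R by rewrite /g /b; field; rewrite lt_eqF.
have gb0 : (0 < g / b)%R by rewrite divr_gt0.
rewrite gb in DN.
have DN' : (D < N)%R.
  by apply: lt_trans DN _; rewrite gtr_pMr// gtrBl.
have sbounds : (N / b < (N - D) / g)%R.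
  rewrite ltr_pdivlMr// -mulrA [(b^-1 * g)%R]mulrC.
  by move: DN; rewrite mulrBr mulr1; lra.
pose s := ((N / b + (N - D) / g) / 2)%R.
have sN : (N / b < s)%R by rewrite /s (midf_lt sbounds).
have sD : (s < (N - D) / g)%R by rewrite /s (midf_lt sbounds).
have s0 : (0 < s)%R by apply: lt_trans sN; rewrite divr_gt0.
have bE : (b = N - q / p * (N - p))%R by rewrite /b g2E opprB.
have sb : (N < s * b)%R by rewrite -ltr_pdivrMr.
have wfin : \int[mu]_x (near_weight E g x `^ s)%:E < +oo.
  apply: (near_weight_integrable E0 M0 EM dimD DN') => //.
  by rewrite -ltr_pdivlMr.
have [C C0 HC] := @weighted_Riesz_potential R n p q b s ((2 + M) `^ b) (M + 1)
  (near_weight E g) p1 pN pq b0 bE (measurable_near_weight E0 g)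
  (near_weight_ge0 E g) (near_weight_support E0 EM g)
  (addr_ge0 M0 ler01) (powR_ge0 _ _) sb wfin.
exists C => // f mf f0; apply: le_trans (HC f mf f0).
rewrite -[gamma1]opprK -[gamma2]opprK.
apply: (integral_HS_weight_le E0 M0 EM dimD DN'); first exact: ltW.
  pose F (z : 'rV[R]_n * 'rV[R]_n) := (`|z.1 - z.2| `^ (- (N - 1)) * f z.2)%:E.
  have mF : measurable_fun [set: _] F.
    apply/measurable_EFinP; apply: measurable_funM.
      by apply: measurable_funT_powR; exact: measurable_rV_dist.
    exact: measurableT_comp mf measurable_snd.
  have F0 z : 0 <= F z by rewrite lee_fin mulr_ge0 ?powR_ge0.
  have mI := @measurable_fun_fubini_tonelli_F _ _ _ _ _ mu F mF F0.
  exact: (measurableT_comp (measurable_poweR q) mI).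
by move=> x; exact: poweR_ge0.
Qed.

End Riesz_Hardy_Sobolev.

(** * Affine change of variables *)

Lemma pushforward_measure d d' (X : measurableType d) (Y : measurableType d')
    (R : realType) (m : {measure set X -> \bar R}) (f : X -> Y) :
  measurable_fun [set: X] f ->
  exists nu : {measure set Y -> \bar R}, (nu : set Y -> \bar R) = pushforward m f.
Proof. by move=> mf; unshelve eexists (pushforward m f). Qed.

Section Change_of_variables.
Context {R : realType}.
Local Notation leb := (@lebesgue_measure R).

Lemma ge0_integral_affine1 (h : measurableTypeR R -> \bar R) (a t : R) :
  (0 < t)%R -> measurable_fun setT h -> (forall x, 0 <= h x) ->
  \int[leb]_x h (a + t * x)%R = (t^-1)%:E * \int[leb]_x h x.
Proof.
move=> t0 mh h0; pose phi (x : measurableTypeR R) : measurableTypeR R := (a + t * x)%R.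
have mphi : measurable_fun [set: measurableTypeR R] phi.
  by apply: measurable_funD => //; exact: measurable_funM.
have [nu nuE] := pushforward_measure leb mphi.
(* Lebesgue measure is t times its image under phi, as seen on intervals *)
have lebE (A : set (measurableTypeR R)) : measurable A ->
    leb A = mscale (NngNum (ltW t0)) nu A.
  move=> mA; apply: (@lebesgue_measure_unique R (mscale (NngNum (ltW t0)) nu)) => //.
  move=> _ [[x y] _ <-].
  transitivity (t%:E * leb (phi @^-1` `]x, y]%classic)); last first.
    by congr (_ * _); rewrite -[LHS]/(pushforward leb phi _) -nuE.
  have -> : phi @^-1` `]x, y]%classic =
      `]((x - a) / t)%R, ((y - a) / t)%R]%classic :> set (measurableTypeR R).
    by apply/seteqP; split=> z /=; rewrite !in_itv/= /phi ltr_pdivrMr//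
      ler_pdivlMr// ltrBlDl lerBrDl (mulrC z).
  rewrite !lebesgue_measure_itv/= !lte_fin ltr_pM2r ?invr_gt0// ltrD2r.
  case: ifP => _; last by rewrite mule0.
  by rewrite -EFinB -EFinM; congr (_%:E); field; rewrite gt_eqF.
have -> : \int[leb]_x h x = \int[mscale (NngNum (ltW t0)) nu]_x h x.
  by apply: eq_measure_integral => A mA _; exact: lebE.
have nuI : \int[nu]_x h x = \int[leb]_x h (phi x).
  transitivity (\int[pushforward leb phi]_x h x); last first.
    by rewrite ge0_integral_pushforward.
  exact: (congr1 (fun m => integral m setT h) nuE).
by rewrite ge0_integral_mscale// nuI muleA -EFinM mulVf ?gt_eqF// mul1e.
Qed.

(** Lebesgue measure in dimension [n.+1] is the image of a product measure. *)
Lemma integral_lebesgue_rV_cons n (h : 'rV[R]_n.+1 -> \bar R) :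
  measurable_fun setT h -> (forall x, 0 <= h x) ->
  \int[lebesgue_rV R n.+1]_v h v =
  \int[@lebesgue_measure R]_x \int[lebesgue_rV R n]_v h (rV_cons (x, v)).
Proof.
move=> mh h0.
rewrite [LHS](_ : _ = \int[(@lebesgue_measure R) \x lebesgue_rV R n]_z
    (h \o @rV_cons R n) z); last first.
  rewrite [LHS]/= /rV_prod.
  have := @ge0_integral_pushforward _ _ _ _ R _ (@measurable_rV_cons R n)
    ((@lebesgue_measure R) \x lebesgue_rV R n) setT h measurableT mh.
  by rewrite preimage_setT; apply.
rewrite fubini_tonelli1//; last by move=> z; exact: h0.
by apply: measurableT_comp => //; exact: measurable_rV_cons.
Qed.

Lemma ge0_integral_affine n (h : 'rV[R]_n -> \bar R) (a : 'rV[R]_n) (t : R) :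
  (0 < t)%R -> measurable_fun setT h -> (forall x, 0 <= h x) ->
  \int[lebesgue_rV R n]_v h (a + t *: v)%R =
  (t ^- n)%:E * \int[lebesgue_rV R n]_v h v.
Proof.
move=> t0; elim: n h a => [|n IH] h a mh h0.
  by rewrite expr0 invr1 mul1e; apply: eq_integral => v _; rewrite (thinmx0 (_ + _)%R) (thinmx0 v).
have maff (m : nat) (b : 'rV[R]_m) :
    measurable_fun [set: 'rV[R]_m] (fun v => b + t *: v)%R.
  apply/measurable_fun_rVP => i.
  rewrite (_ : _ \o _ = fun v : 'rV[R]_m => b ord0 i + t * rV_coord i v)%R.
    apply: measurable_funD => //; apply: measurable_funM => //.
    exact: measurable_rV_coord.
  by apply/funext => v; rewrite /rV_coord /= !mxE.
rewrite integral_lebesgue_rV_cons//; last exact: measurableT_comp (maff _ a).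
pose a0 := (rV_uncons a).1; pose a' := (rV_uncons a).2.
have cons_aff x v : (a + t *: rV_cons (x, v) = rV_cons (a0 + t * x, a' + t *: v))%R.
  apply/rowP => i; rewrite !mxE; case: unliftP => [j ->|->]/=.
    by rewrite !mxE.
  by [].
under eq_integral => x _ do under eq_integral => v _ do rewrite cons_aff.
have mh2 : measurable_fun setT (h \o @rV_cons R n).
  by apply: measurableT_comp => //; exact: measurable_rV_cons.
have mh1 x : measurable_fun setT (fun v : 'rV[R]_n => h (rV_cons (x, v))).
  exact: (@measurableT_comp _ _ _ _ _ _ (h \o @rV_cons R n) _
    (fun v : 'rV[R]_n => (x : measurableTypeR R, v)) mh2 (measurable_pair1 x)).
pose H (x : measurableTypeR R) := \int[lebesgue_rV R n]_v h (rV_cons (x, v)).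
have mH : measurable_fun setT H.
  exact: (@measurable_fun_fubini_tonelli_F _ _ _ _ _ (lebesgue_rV R n) _ mh2
    (fun z => h0 _)).
have H0 x : 0 <= H x by exact: integral_ge0.
transitivity (\int[@lebesgue_measure R]_x ((t ^- n)%:E * H (a0 + t * x)%R)).
  apply: eq_integral => x _.
  exact: (IH (fun v => h (rV_cons (a0 + t * x, v)%R)) a' (mh1 _)).
rewrite ge0_integralZl//; last first.
- by rewrite lee_fin invr_ge0 exprn_ge0// ltW.
- apply: measurableT_comp => //.
  by apply: measurable_funD => //; exact: measurable_funM.
rewrite ge0_integral_affine1// muleA -EFinM -invfM -exprSr.
by rewrite integral_lebesgue_rV_cons.
Qed.

End Change_of_variables.

(** * Pointwise bound of a C^1 function by the Riesz potential of its gradient *)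

Section Ray_bound.
Context {R : realType} {n : nat}.
Local Notation leb := (@lebesgue_measure R).
Implicit Types (f : 'rV[R]_n -> R) (x v : 'rV[R]_n).

Lemma continuous_enorm_gradient f : C1 f -> continuous (fun x => enorm (gradient f x)).
Proof.
move=> [_ cf]; rewrite (_ : (fun x => _) =
    (fun x => Num.sqrt (\sum_(i < n) partial f i x ^+ 2))%R).
  exact: continuous_sqrt_sum_sqr.
by apply/funext => x; congr Num.sqrt; apply: eq_bigr => i _; rewrite mxE.
Qed.

Lemma derive_sum_partial f x v : differentiable f x ->
  ('D_v f x = \sum_(i < n) v ord0 i * partial f i x)%R.
Proof.
move=> df; rewrite deriveE// {1}[v]row_sum_delta linear_sum /=.
by apply: eq_bigr => i _; rewrite linearZ /partial deriveE.
Qed.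

Lemma norm_derive_le f x v : differentiable f x ->
  (`|'D_v f x| <= n%:R * `|v| * enorm (gradient f x))%R.
Proof.
move=> df; rewrite derive_sum_partial// (le_trans (ler_norm_sum _ _ _))//.
rewrite (@le_trans _ _ (\sum_(i < n) `|v| * enorm (gradient f x))%R)//; last first.
  by rewrite sumr_const card_ord -[X in (X <= _)%R]mulr_natl mulrA.
apply: ler_sum => i _; rewrite normrM ler_pM//.
  by have /rV_norm_leP : (`|v| <= `|v|)%R by []; apply.
have /rV_norm_leP : (`|gradient f x| <= enorm (gradient f x))%R.
  exact: norm_le_enorm.
by move=> /(_ (enorm_ge0 _) i); rewrite mxE.
Qed.

Section along_a_ray.
Variables (f : 'rV[R]_n -> R) (x v : 'rV[R]_n).
Hypothesis C1f : C1 f.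
Let phi (t : R) := f (x + t *: v)%R.

Let derivable_phi t : derivable phi t 1%R /\ (derive1 phi t = 'D_v f (x + t *: v))%R.
Proof.
have [df _] := C1f.
have E : (fun h => h^-1 *: ((phi \o shift t) (h *: 1) - phi t))%R =
    (fun h => h^-1 *: ((f \o shift (x + t *: v)) (h *: v) - f (x + t *: v)))%R.
  apply/funext => h; rewrite /phi /=; congr (_ *: (f _ - _))%R.
  by rewrite [(h *: 1)%R]mulr1 scalerDl addrCA.
split; last by rewrite derive1E /derive E.
rewrite /derivable E; exact: (@diff_derivable _ _ _ f (x + t *: v)%R v (df _)).
Qed.

Let continuous_ray : continuous (fun t : R => x + t *: v)%R.
Proof.
move=> t.
have c1 : {for t, continuous (fun _ : R => x)} by exact: cst_continuous.
have c2 : {for t, continuous (fun k : R => k *: v)%R} by exact: scalel_continuous.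
exact: continuousD c1 c2.
Qed.

Let continuous_dphi : continuous (fun t : R => 'D_v f (x + t *: v))%R.
Proof.
have [df cf] := C1f.
rewrite (_ : (fun t => _) =
    (fun t : R => \sum_(i <- index_enum 'I_n) v ord0 i * partial f i (x + t *: v)))%R; last first.
  by apply/funext => t; rewrite derive_sum_partial.
elim: (index_enum _) => [|i s IH].
  rewrite (_ : (fun t => _) = fun=> 0%R); first exact: cst_continuous.
  by apply/funext => u; rewrite big_nil.
rewrite (_ : (fun t => _) = (fun t : R => v ord0 i * partial f i (x + t *: v)
    + \sum_(j <- s) v ord0 j * partial f j (x + t *: v)))%R; last first.
  by apply/funext => u; rewrite big_cons.
have ci : continuous (fun t : R => partial f i (x + t *: v))%R.
  by move=> t; apply: continuous_comp; [exact: continuous_ray|exact: cf].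
move=> t; apply: continuousD (IH t).
have c1 : {for t, continuous (fun _ : R => v ord0 i)} by exact: cst_continuous.
exact: continuousM c1 (ci t).
Qed.

Lemma ray_increment (T : R) : (0 < T)%R ->
  (`|f (x + T *: v) - f x|)%:E <=
  \int[leb]_(t in `]0%R, +oo[) (n%:R * `|v| * enorm (gradient f (x + t *: v)))%:E.
Proof.
have [df cf] := C1f; move=> T0.
have cphi t : {for t, continuous phi}.
  apply: differentiable_continuous; apply/derivable1_diffP.
  by have [] := derivable_phi t.
have FTC := @continuous_FTC2 R (fun t => 'D_v f (x + t *: v))%R phi 0%R T T0.
have {}FTC : \int[leb]_(t in `[0%R, T]) ('D_v f (x + t *: v))%:E =
    (phi T)%:E - (phi 0%R)%:E.
  apply: FTC.
  - exact: continuous_subspaceT.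
  - split.
    + by move=> t _; have [] := derivable_phi t.
    + by apply: cvg_at_right_filter; exact: cphi.
    + by apply: cvg_at_left_filter; exact: cphi.
  - by move=> t _; have [] := derivable_phi t.
have mD : measurable_fun [set: R] (fun t => 'D_v f (x + t *: v))%R.
  exact: continuous_measurable_fun.
have -> : (`|f (x + T *: v) - f x|)%:E =
    `| \int[leb]_(t in `]0%R, T]) ('D_v f (x + t *: v))%:E |.
  rewrite integral_itv_obnd_cbnd; last first.
    by apply/measurable_EFinP; exact: measurable_funTS.
  by rewrite FTC -EFinB /phi scale0r addr0.
apply: le_trans (le_abse_integral _ _ _) _ => //.
  by apply/measurable_EFinP; exact: measurable_funTS.
apply: (@le_trans _ _ (\int[leb]_(t in `]0%R, T])
    (n%:R * `|v| * enorm (gradient f (x + t *: v)))%:E)).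
  apply: le_integral_ge0 => t _; first by [].
  by rewrite lee_fin norm_derive_le.
rewrite [leLHS]integral_mkcond [leRHS]integral_mkcond.
apply: le_integral_ge0 => t _.
  by apply: erestrict_ge0 => s _; rewrite lee_fin !mulr_ge0 ?enorm_ge0.
rewrite !patchE; case: ifPn => [/set_mem /=|_].
  by rewrite in_itv/= => /andP[t0 _]; rewrite mem_set//= in_itv/= t0.
by case: ifPn => // _; rewrite lee_fin !mulr_ge0 ?enorm_ge0.
Qed.

End along_a_ray.

(** Integrate the derivative of [f] from [x] to infinity along the ray in
    direction [v], where [f] tends to zero. *)
Lemma ray_bound f x v : C10 f -> (0 < `|v|)%R ->
  (`|f x|)%:E <=
  \int[leb]_(t in `]0%R, +oo[) (n%:R * `|v| * enorm (gradient f (x + t *: v)))%:E.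
Proof.
move=> [C1f f0] v0; apply/lee_addgt0Pr => e e0.
have [M HM] := f0 _ e0.
pose T := ((`|M| + `|x| + 1) / `|v|)%R.
have T0 : (0 < T)%R by rewrite divr_gt0// ltr_wpDl// addr_ge0.
have fT : (`|f (x + T *: v)| < e)%R.
  apply: HM; apply: lt_le_trans (norm_le_enorm _).
  have : (`|T *: v| = `|M| + `|x| + 1)%R by rewrite normrZ gtr0_norm// divfK ?gt_eqF.
  have := ler_normB (x + T *: v)%R x; rewrite addrC addrA addNr add0r.
  have := ler_norm M; lra.
apply: (@le_trans _ _ ((`|f (x + T *: v) - f x|)%:E + (`|f (x + T *: v)|)%:E)).
  rewrite -EFinD lee_fin -[X in (`|X| <= _)%R](subKr (f (x + T *: v)%R)).
  by rewrite (le_trans (ler_normB _ _))// addrC.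
by apply: leeD; [exact: ray_increment|rewrite lee_fin ltW].
Qed.

End Ray_bound.

Section Representation.
Context {R : realType} {n : nat}.
Local Notation leb := (@lebesgue_measure R).
Local Notation mu := (lebesgue_rV R n).
Local Notation N := (n%:R : R).
Implicit Types (x y v : 'rV[R]_n).

Let S : set 'rV[R]_n := [set v | forall i, (1 <= v ord0 i <= 2)%R].

Let measurable_S : measurable S.
Proof.
rewrite (_ : S = \bigcap_(i in [set: 'I_n]) @rV_coord R n i @^-1` `[1%R, 2%R]%classic).
  apply: fin_bigcap_measurable => // i _.
  by rewrite -[X in measurable X]setTI; apply: measurable_rV_coord.
apply/seteqP; split=> [v vS i _|v vS i] /=; first by rewrite in_itv; exact: vS.
by have := vS i Logic.I; rewrite /= in_itv.
Qed.

Let lebesgue_S : mu S = 1.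
Proof.
have := @lebesgue_rV_box R n (const_mx 1%R) (const_mx 2%R).
have -> : [set v : 'rV[R]_n | forall i, ((const_mx 1 : 'rV[R]_n) ord0 i <= v ord0 i
    <= (const_mx 2 : 'rV[R]_n) ord0 i)%R] = S.
  by apply/seteqP; split=> v vS i; have := vS i; rewrite !mxE.
move=> ->; last by move=> i; rewrite !mxE ler1n.
congr (_%:E); rewrite big1// => i _; rewrite !mxE.
by rewrite (_ : 2 - 1 = 1)%R//; ring.
Qed.

Let S_norm v : (0 < n)%N -> S v -> (1 <= `|v| <= 2)%R.
Proof.
move=> n0 vS; apply/andP; split.
  have := (elimT (rV_norm_leP v (normr_ge0 v)) (lexx _)) (Ordinal n0).
  have /andP[v1 _] := vS (Ordinal n0).
  by move=> P; apply: le_trans P; rewrite ger0_norm// (le_trans ler01).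
apply/rV_norm_leP => // i; have /andP[v1 v2] := vS i.
by rewrite ger0_norm// (le_trans ler01).
Qed.

(** For fixed [t], the substitution [y = x + t v] gives each [y] the weight
    [t^-n], and [v] can lie in the cube [[1, 2]^n] only if
    [|x - y| / 2 <= t <= |x - y|].  The integral of [t^-n] over these [t] is at
    most a multiple of [|x - y|^(1 - n)]. *)
Lemma averaged_rays_le (g : 'rV[R]_n -> R) x : (1 < n)%N ->
  measurable_fun [set: 'rV[R]_n] g -> (forall y, (0 <= g y)%R) ->
  \int[mu]_(v in S) \int[leb]_(t in `]0%R, +oo[) (g (x + t *: v)%R)%:E <=
  (2^-1 `^ (1 - N))%:E * \int[mu]_y (`|x - y| `^ (- (N - 1)) * g y)%:E.
Proof.
move=> n1 mg g0; have n0 : (0 < n)%N by exact: ltnW.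
pose I : set R := `]0%R, +oo[%classic.
have mI : measurable (I : set (measurableTypeR R)) by exact: measurable_itv.
have mS1 : measurable_fun [set: 'rV[R]_n] (\1_S : 'rV[R]_n -> R).
  exact: measurable_indic.
have mI1 : measurable_fun [set: measurableTypeR R] (\1_I : measurableTypeR R -> R).
  exact: measurable_indic.
pose F (z : 'rV[R]_n * measurableTypeR R) :=
  (g (x + z.2 *: z.1)%R * \1_S z.1 * \1_I z.2)%:E.
have F0 z : 0 <= F z by rewrite lee_fin !mulr_ge0.
have mF : measurable_fun setT F.
  apply/measurable_EFinP; apply: measurable_funM; first apply: measurable_funM.
  - apply: (measurableT_comp mg); apply/measurable_fun_rVP => i.
    rewrite (_ : _ \o _ = fun z : 'rV[R]_n * measurableTypeR R =>
        x ord0 i + z.2 * rV_coord i z.1)%R; last first.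
      by apply/funext => z; rewrite /rV_coord /= !mxE.
    apply: measurable_funD => //; apply: measurable_funM; first exact: measurable_snd.
    exact: measurableT_comp (measurable_rV_coord i) measurable_fst.
  - exact: measurableT_comp mS1 measurable_fst.
  - exact: measurableT_comp mI1 measurable_snd.
have -> : \int[mu]_(v in S) \int[leb]_(t in `]0%R, +oo[) (g (x + t *: v)%R)%:E =
    \int[mu]_v \int[leb]_t F (v, t).
  rewrite [LHS]integral_mkcond; apply: eq_integral => v _; rewrite patchE.
  case: ifPn => [/set_mem vS|/negP vS].
    rewrite [LHS]integral_mkcond; apply: eq_integral => t _.
    rewrite patchE /F /= !indicE (mem_set vS) mulr1 -/I.
    by case: (t \in I); rewrite ?mulr1 ?mulr0.
  rewrite [RHS]integral0_eq// => t _; rewrite /F /= indicE memNset ?mulr0 ?mul0r//.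
  by move=> /mem_set.
rewrite (fubini_tonelli F mF F0).
pose B1 := [set z : measurableTypeR R * 'rV[R]_n | (z.1 <= `|x - z.2|)%R].
pose B2 := [set z : measurableTypeR R * 'rV[R]_n | (`|x - z.2| <= 2 * z.1)%R].
pose A (z : measurableTypeR R * 'rV[R]_n) : R := (\1_I z.1 * \1_B1 z * \1_B2 z)%R.
pose K z := (g z.2 * (z.1 `^ (- N) * A z))%:E.
have K0 z : 0 <= K z by rewrite lee_fin !mulr_ge0 ?powR_ge0.
have mK : measurable_fun setT K.
  have md : measurable_fun setT (fun z : measurableTypeR R * 'rV[R]_n => `|x - z.2|%R).
    exact: measurableT_comp (measurable_rV_distl x) measurable_snd.
  have mfst : measurable_fun setT (fun z : measurableTypeR R * 'rV[R]_n => z.1).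
    exact: measurable_fst.
  apply/measurable_EFinP; apply: measurable_funM.
    exact: measurableT_comp mg measurable_snd.
  apply: measurable_funM; first exact: measurable_funT_powR.
  apply: measurable_funM; first apply: measurable_funM.
  - exact: measurableT_comp mI1 measurable_fst.
  - by apply: measurable_indic; exact: measurable_le_set.
  - apply: measurable_indic; apply: measurable_le_set => //.
    exact: measurable_funM.
apply: (@le_trans _ _ (\int[leb]_t \int[mu]_y K (t, y))).
  apply: le_integral_ge0 => t _; first by apply: integral_ge0 => v _; exact: F0.
  have [tI|tI] := boolP (t \in I); last first.
    rewrite integral0_eq; first by apply: integral_ge0 => y _; exact: K0.
    by move=> v _; rewrite /F /= [X in (_ * X)%R]indicE (negbTE tI) mulr0.
  have t0 : (0 < t)%R by move/set_mem: tI; rewrite /I /= in_itv/= andbT.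
  pose h y := (g y * \1_S (t^-1 *: (y - x))%R)%:E.
  have -> : \int[mu]_v F (v, t) = \int[mu]_v h (x + t *: v)%R.
    apply: eq_integral => v _; rewrite /F /h /= [X in (_ * X)%R]indicE tI mulr1.
    by rewrite (addrC x) addrK scalerA mulVf ?scale1r// gt_eqF.
  have mw : measurable_fun [set: 'rV[R]_n] (fun y => t^-1 *: (y - x))%R.
    apply/measurable_fun_rVP => i.
    rewrite (_ : _ \o _ = fun y : 'rV[R]_n => t^-1 * (rV_coord i y - x ord0 i))%R; last first.
      by apply/funext => y; rewrite /rV_coord /= !mxE.
    apply: measurable_funM => //; apply: measurable_funB => //.
    exact: measurable_rV_coord.
  rewrite (ge0_integral_affine _ t0); last 2 first.
  - apply/measurable_EFinP; apply: measurable_funM => //.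
    exact: measurableT_comp mS1 mw.
  - by move=> y; rewrite lee_fin mulr_ge0.
  rewrite -ge0_integralZl_EFin; last 4 first.
  - by [].
  - by move=> y _; rewrite lee_fin mulr_ge0.
  - apply/measurable_EFinP; apply: measurable_funM => //.
    exact: measurableT_comp mS1 mw.
  - by rewrite invr_ge0 exprn_ge0// ltW.
  apply: le_integral_ge0 => y _.
    by rewrite -EFinM lee_fin mulr_ge0 ?mulr_ge0// invr_ge0 exprn_ge0// ltW.
  rewrite -EFinM /K lee_fin /=.
  have [/set_mem yS|yS] := boolP ((t^-1 *: (y - x))%R \in S); last first.
    by rewrite indicE (negbTE yS) !mulr0 mulr_ge0 ?mulr_ge0 ?powR_ge0.
  have := S_norm n0 yS; rewrite normrZ gtr0_norm ?invr_gt0// distrC.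
  rewrite mulrC ler_pdivlMr// ler_pdivrMr// mul1r => /andP[t1 t2].
  rewrite /A /= !indicE tI mem_set// mem_set// mem_set// !mulr1 mulrC.
  by rewrite powRN powR_mulrn// ltW.
rewrite [leLHS](fubini_tonelli (m1 := leb) (m2 := mu) K mK K0).
rewrite -ge0_integralZl_EFin; last 4 first.
- by [].
- by move=> y _; rewrite lee_fin mulr_ge0 ?powR_ge0.
- apply/measurable_EFinP; apply: measurable_funM => //.
  by apply: measurable_funT_powR; exact: measurable_rV_distl.
- exact: powR_ge0.
apply: le_integral_ge0 => y _; first by apply: integral_ge0 => t _; exact: K0.
have [r0|r0] := leP (`|x - y|)%R 0%R.
  rewrite integral0_eq; first by rewrite mule_ge0 ?lee_fin ?mulr_ge0 ?powR_ge0.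
  move=> t _; rewrite /K /A /= !indicE.
  have [/set_mem tI|_] := boolP (t \in I); last by rewrite !(mul0r, mulr0).
  rewrite (memNset (A := B1)) ?(mul0r, mulr0)//=.
  move: tI; rewrite /I /= in_itv/= andbT => t0 tr.
  by have := lt_le_trans t0 (le_trans tr r0); rewrite ltxx.
set r := (`|x - y|)%R in r0 *.
have r2 : (0 < 2^-1 * r)%R by rewrite mulr_gt0.
pose J : set (measurableTypeR R) := `[(2^-1 * r)%R, r]%classic.
have mJ : measurable J by exact: measurable_itv.
apply: (@le_trans _ _ (\int[leb]_t ((g y * (2^-1 * r) `^ (- N))%:E * (\1_J t)%:E))).
  apply: le_integral_ge0 => t _; first exact: K0.
  rewrite -EFinM lee_fin /= -mulrA ler_wpM2l//.
  rewrite /A /= !indicE -/r.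
  case: (boolP (t \in I)) => _; last by rewrite !(mul0r, mulr0) mulr_ge0 ?powR_ge0.
  have [/set_mem/= t1|_] := boolP ((t, y) \in B1); last first.
    by rewrite !(mul0r, mulr0) mulr_ge0 ?powR_ge0.
  have [/set_mem/= t2|_] := boolP ((t, y) \in B2); last first.
    by rewrite !(mul0r, mulr0) mulr_ge0 ?powR_ge0.
  have t2' : (2^-1 * r <= t)%R by rewrite ler_pdivrMl.
  rewrite mem_set ?mulr1; last by rewrite /J /= in_itv/= t2'.
  exact: ler_powRN.
rewrite ge0_integralZl_EFin; last 4 first.
- by [].
- by move=> t _; rewrite lee_fin.
- by apply/measurable_EFinP; exact: measurable_indic.
- by rewrite mulr_ge0 ?powR_ge0.
rewrite integral_indic// setIT [X in _ * X]lebesgue_measure_itv/= lte_fin.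
have r2r : (2^-1 * r < r)%R by rewrite gtr_pMl// invf_lt1 ?ltr1n.
rewrite r2r -EFinB -!EFinM lee_fin le_eqVlt; apply/orP; left; apply/eqP.
have -> : (r - 2^-1 * r = (2^-1 * r) `^ 1)%R by rewrite powRr1 ?(ltW r2)//; field.
rewrite -mulrA -powRD; last by apply/implyP => _; rewrite gt_eqF.
by rewrite powRM ?(ltW r0)// mulrC mulrA addrC opprB.
Qed.

(** Average the ray bound over the directions [v] in the unit-volume cube
    [[1, 2]^n], which stays away from the origin. *)
Lemma C10_le_Riesz (f : 'rV[R]_n -> R) x : (1 < n)%N -> C10 f ->
  (`|f x|)%:E <= (N * 2 * 2^-1 `^ (1 - N))%:E *
    \int[mu]_y (`|x - y| `^ (- (N - 1)) * enorm (gradient f y))%:E.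
Proof.
move=> n1 f10; have n0 : (0 < n)%N by exact: ltnW.
pose g y := enorm (gradient f y).
have g0 y : (0 <= g y)%R by exact: enorm_ge0.
have mg : measurable_fun [set: 'rV[R]_n] g.
  by apply: continuous_measurable_rV; apply: continuous_enorm_gradient; case: f10.
have -> : (`|f x|)%:E = \int[mu]_(v in S) (`|f x|)%:E.
  by rewrite integral_cst// [X in _ * X]lebesgue_S mule1.
apply: (@le_trans _ _ (\int[mu]_(v in S)
    \int[leb]_(t in `]0%R, +oo[) (N * 2 * g (x + t *: v)%R)%:E)).
  apply: le_integral_ge0 => v vS; first by rewrite lee_fin.
  have /andP[v1 v2] := S_norm n0 vS.
  apply: (le_trans (ray_bound x f10 (lt_le_trans ltr01 v1))).
  apply: le_integral_ge0 => t _; first by rewrite lee_fin !mulr_ge0 ?enorm_ge0.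
  by rewrite lee_fin; apply: ler_wpM2r; [exact: g0|exact: ler_wpM2l].
apply: le_trans (@averaged_rays_le (fun y => N * 2 * g y)%R x n1 _ _) _.
- exact: measurable_funM.
- by move=> y; rewrite mulr_ge0 ?mulr_ge0.
have -> : \int[mu]_y (`|x - y| `^ (- (N - 1)) * (N * 2 * g y))%:E =
    (N * 2)%:E * \int[mu]_y (`|x - y| `^ (- (N - 1)) * g y)%:E.
  rewrite -ge0_integralZl_EFin; last 4 first.
  - by [].
  - by move=> y _; rewrite lee_fin mulr_ge0 ?powR_ge0.
  - apply/measurable_EFinP; apply: measurable_funM => //.
    by apply: measurable_funT_powR; exact: measurable_rV_distl.
  - by rewrite mulr_ge0.
  by apply: eq_integral => y _; rewrite -EFinM; congr (_%:E); rewrite mulrCA.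
by rewrite muleA -EFinM [(_ * (N * 2))%R]mulrC.
Qed.

End Representation.

(** * The Hardy-Sobolev inequality *)

Section Conclusion.
Context {R : realType} {n : nat}.
Local Notation mu := (lebesgue_rV R n).
Local Notation N := (n%:R : R).
Implicit Types (x y : 'rV[R]_n).

Lemma poweR_root_le (X Y : \bar R) (C p q : R) :
  (0 < p)%R -> (0 < q)%R -> (0 <= C)%R -> 0 <= X -> 0 <= Y ->
  X <= C%:E * Y `^ (q / p) ->
  X `^ q^-1 <= (C `^ q^-1)%:E * Y `^ p^-1.
Proof.
move=> p0 q0 C0 X0 Y0 XY.
apply: (@le_trans _ _ ((C%:E * Y `^ (q / p)) `^ q^-1)).
  apply: gt0_ler_poweR; rewrite ?in_itv/= ?leey ?andbT ?invr_ge0 ?(ltW q0)//.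
  by rewrite mule_ge0// poweR_ge0.
rewrite poweRM ?poweR_ge0// -poweRrM; have -> // : (q / p / q = p^-1)%R.
by field; rewrite !gt_eqF.
Qed.

(** On the diagonal both sides are the same power of [0]. *)
Lemma powR_enorm_le x y : (0 < n)%N ->
  (enorm (x - y) `^ (- (n.-1)%:R) <= `|x - y| `^ (- (N - 1)))%R.
Proof.
move=> n0; have -> : ((n.-1)%:R = N - 1)%R by rewrite -subn1 natrB.
have N10 : (0 <= N - 1)%R by rewrite subr_ge0 ler1n.
have [->|xy] := eqVneq x y.
  by rewrite subrr normr0 /enorm big1 ?sqrtr0// => i _; rewrite mxE expr0n.
by apply: ler_powRN; rewrite ?normr_gt0 ?subr_eq0// norm_le_enorm.
Qed.

Lemma Riesz1_le (f : 'rV[R]_n -> R) x : (0 < n)%N ->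
  measurable_fun [set: 'rV[R]_n] f ->
  `|Riesz1 f x| <= \int[mu]_y (`|x - y| `^ (- (N - 1)) * `|f y|)%:E.
Proof.
move=> n0 mf; rewrite /Riesz1.
have E y : (f y / enorm (x - y) ^+ n.-1 = f y * enorm (x - y) `^ (- (n.-1)%:R))%R.
  by rewrite powR_invn// enorm_ge0.
under eq_integral do rewrite E.
apply: le_trans (le_abse_integral _ _ _) _ => //.
  apply/measurable_EFinP; apply: measurable_funM => //.
  apply: measurable_funT_powR; apply: (continuous_measurable_rV
    (f := fun y => enorm (x - y))) => y.
  apply: (@continuous_comp _ _ _ (fun y : 'rV[R]_n => x - y)%R).
    by apply: (@continuousB _ _ _ (cst x) id); [exact: cst_continuous|exact: cvg_id].
  exact: continuous_enorm.
apply: le_integral_ge0 => y _; first by [].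
rewrite /= lee_fin normrM mulrC [X in (X * _ <= _)%R]ger0_norm ?powR_ge0//.
by rewrite ler_wpM2r// powR_enorm_le.
Qed.

End Conclusion.

Theorem corollary1p4 (R : realType) (n : nat) (p q : R)
    (hp1 : (1 < p)%R) (hpn : (p < n%:R)%R)
    (hpq : (p <= q)%R) (hqn : (q < n%:R * p / (n%:R - p))%R)
    (E : set 'rV[R]_n) (hE : median_porous E)
    (hdiam0 : 0 < ediam E) (hdiam : ediam E < +oo)
    (gamma1 gamma2 : R)
    (hg1 : (gamma1 < 0)%R)
    (hg1E : (q / p * (n%:R - p) - n%:R)%:E *
            (1 - upper_Minkowski_dim E * (n%:R^-1)%:E) < gamma1%:E)
    (hg2 : (gamma2 < 0)%R)
    (hg2eq : gamma2 = (q / p * (n%:R - p) - n%:R)%R)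
    (hg2E : - Muckenhoupt_exponent E < gamma2%:E) :
  exists2 C : R, (0 < C)%R &
    (forall f : 'rV[R]_n -> R, f \in Lfun (lebesgue_rV R n) p%:E ->
       (\int[lebesgue_rV R n]_x
          (`|Riesz1 f x| `^ q * HS_weight E gamma1 gamma2 x)) `^ q^-1
       <= C%:E *
          (\int[lebesgue_rV R n]_x (`|f x| `^ p)%:E) `^ p^-1)
    /\
    (forall f : 'rV[R]_n -> R, C10 f ->
       (\int[lebesgue_rV R n]_x
          ((`|f x| `^ q)%:E * HS_weight E gamma1 gamma2 x)) `^ q^-1
       <= C%:E *
          (\int[lebesgue_rV R n]_x (enorm (gradient f x) `^ p)%:E) `^ p^-1).
Proof.
have n1 : (1 < n)%N by rewrite -(@ltr1n R); exact: lt_trans hpn.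
have n0 : (0 < n)%N by exact: ltnW.
have p0 : (0 < p)%R by exact: lt_trans hp1.
have q0 : (0 < q)%R by exact: lt_le_trans hpq.
rewrite -hg2eq in hg1E.
have [C1 C10_ HC1] :=
  Riesz_potential_HS_weight hp1 hpn hpq hE.1 hdiam hg1 hg2 hg1E hg2eq.
have HS0 x : 0 <= HS_weight E gamma1 gamma2 x.
  by rewrite /HS_weight le_min !expeR_ge0.
pose c0 : R := (n%:R * 2 * 2^-1 `^ (1 - n%:R))%R.
have c00 : (0 < c0)%R by rewrite !mulr_gt0 ?powR_gt0 ?invr_gt0// ltr0n.
pose I (f : 'rV[R]_n -> R) x : \bar R :=
  \int[lebesgue_rV R n]_y (`|x - y| `^ (- (n%:R - 1)) * f y)%:E.
have HI (u : 'rV[R]_n -> \bar R) (f : 'rV[R]_n -> R) :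
    measurable_fun [set: 'rV[R]_n] f -> (forall y, (0 <= f y)%R) ->
    (forall x, 0 <= u x <= I f x) ->
    (\int[lebesgue_rV R n]_x (u x `^ q * HS_weight E gamma1 gamma2 x)) `^ q^-1
    <= (C1 `^ q^-1)%:E * (\int[lebesgue_rV R n]_x (f x `^ p)%:E) `^ p^-1.
  move=> mf f0 uI; apply: poweR_root_le => //; rewrite ?(ltW C10_)//.
  - by apply: integral_ge0 => x _; rewrite mule_ge0 ?poweR_ge0.
  - by apply: integral_ge0 => x _; rewrite lee_fin powR_ge0.
  apply: le_trans (HC1 f mf f0); apply: le_integral_ge0 => x _.
    by rewrite mule_ge0 ?poweR_ge0.
  have /andP[u0 uIx] := uI x; apply: lee_wpmul2r => //.
  apply: gt0_ler_poweR; rewrite ?(ltW q0)// in_itv/= leey andbT//.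
  exact: le_trans uIx.
exists (C1 `^ q^-1 * (1 + c0))%R.
  by rewrite mulr_gt0 ?powR_gt0// addr_gt0.
split=> f.
  move=> /sub_Lfun_mfun; rewrite inE/= => mf.
  apply: (@le_trans _ _ ((C1 `^ q^-1)%:E *
      (\int[lebesgue_rV R n]_x (`|f x| `^ p)%:E) `^ p^-1)).
    apply: (HI (fun x => `|Riesz1 f x|) (fun y => `|f y|)%R) => //.
    - exact: measurableT_comp.
    - by move=> x; rewrite abse_ge0 Riesz1_le.
  apply: lee_wpmul2r; first exact: poweR_ge0.
  by rewrite lee_fin ler_peMr ?powR_ge0// lerDl ltW.
move=> f10.
have mg : measurable_fun [set: 'rV[R]_n] (fun y => enorm (gradient f y)).
  by apply: continuous_measurable_rV; apply: continuous_enorm_gradient; case: f10.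
apply: (@le_trans _ _ ((C1 `^ q^-1)%:E *
    (\int[lebesgue_rV R n]_x ((c0 * enorm (gradient f x)) `^ p)%:E) `^ p^-1)).
  apply: (HI (fun x => (`|f x|)%:E) (fun y => c0 * enorm (gradient f y))%R).
  - exact: measurable_funM.
  - by move=> y; rewrite mulr_ge0 ?enorm_ge0// ltW.
  move=> x; rewrite lee_fin normr_ge0 /=.
  apply: le_trans (C10_le_Riesz x n1 f10) _; rewrite -/c0.
  rewrite -ge0_integralZl_EFin; last 4 first.
  - by [].
  - by move=> y _; rewrite lee_fin mulr_ge0 ?powR_ge0 ?enorm_ge0.
  - apply/measurable_EFinP; apply: measurable_funM => //.
    by apply: measurable_funT_powR; exact: measurable_rV_distl.
  - exact: ltW.
  apply: le_integral_ge0 => y _.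
    by rewrite -EFinM lee_fin !mulr_ge0 ?powR_ge0 ?enorm_ge0// ltW.
  by rewrite -EFinM lee_fin mulrCA.
have -> : \int[lebesgue_rV R n]_x ((c0 * enorm (gradient f x)) `^ p)%:E =
    (c0 `^ p)%:E * \int[lebesgue_rV R n]_x (enorm (gradient f x) `^ p)%:E.
  rewrite -ge0_integralZl_EFin; last 4 first.
  - by [].
  - by move=> y _; rewrite lee_fin powR_ge0.
  - by apply/measurable_EFinP; exact: measurable_funT_powR.
  - exact: powR_ge0.
  by apply: eq_integral => x _; rewrite powRM ?enorm_ge0 ?(ltW c00).
rewrite poweRM ?lee_fin ?powR_ge0//; last first.
  by apply: integral_ge0 => x _; rewrite lee_fin powR_ge0.
rewrite poweR_EFin -powRrM mulfV ?gt_eqF// powRr1 ?(ltW c00)// muleA -EFinM.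
apply: lee_wpmul2r; first exact: poweR_ge0.
by rewrite lee_fin ler_wpM2l ?powR_ge0// lerDr.
Qed.
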